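(* Let $n\ge1$ and let $\delta$ be an $n$-core. Let $X=(x_i)$, $Y=(y_j)$, $W=(w_k)$, $Z=(z_\ell)$ be finite lists of variables. Then, as formal power series in these variables, $$\sum_{\lambda:\ \widetilde\lambda=\delta}\mathcal G^{(n)}_{\lambda/\delta}(X/Y;q)\,\mathcal G^{(n)}_{\lambda/\delta}(W/Z;q)=\prod_{t=0}^{n-1}\frac{\prod_{i,\ell}(1-q^{2t}x_iz_\ell)\ \prod_{j,k}(1-q^{2t}y_jw_k)}{\prod_{i,k}(1-q^{2t}x_iw_k)\ \prod_{j,\ell}(1-q^{2t}y_jz_\ell)},$$ where $\widetilde\lambda$ denotes the $n$-core of $\lambda$.
   Context: Partitions are identified with Young diagrams (left-justified rows, the $i$-th row from the top having $\lambda_i$ boxes). An $n$-ribbon is a connected skew shape with $n$ boxes containing no $2\times2$ square; its spin is its number of rows minus one. An $n$-core is a partition from which no $n$-ribbon can be removed leaving a partition; the $n$-core $\widetilde\lambda$ of $\lambda$ is the partition obtained by removing $n$-ribbons from $\lambda$ as long as possible. A tiling of a skew shape by $n$-ribbons is a horizontal $n$-ribbon strip if the top-right-most square of each ribbon touches the northern boundary of the shape (the square directly above it is not in the shape); it is a vertical $n$-ribbon strip if its reflection in the main diagonal is a horizontal $n$-ribbon strip of the conjugate shape. Let $A=\{1,\dots,p\}$, $A'=\{1',\dots,s'\}$ with a total order $\prec$ on $A\sqcup A'$ respecting the orders on $A$ and $A'$. A super $n$-ribbon tableau $T$ of shape $\lambda/\mu$ is a tiling of $\lambda/\mu$ by $n$-ribbons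 labelled by $A\sqcup A'$ such that, for each label $i$, $\mu$ together with the ribbons with labels $\preceq i$ is a Young diagram, the ribbons labelled by any $a\in A$ form a horizontal $n$-ribbon strip, and the ribbons labelled by any $b\in A'$ form a vertical $n$-ribbon strip. $\operatorname{spin}(T)$ is the sum of the spins of its ribbons; $\operatorname{wt}(T)$, $\operatorname{wt}'(T)$ record the number of ribbons with each label in $A$, $A'$. For $X=(x_1,\dots,x_p)$, $Y=(y_1,\dots,y_s)$ the super LLT polynomial is $$\mathcal G^{(n)}_{\lambda/\mu}(X/Y;q)=\sum_Tq^{\operatorname{spin}(T)}x^{\operatorname{wt}(T)}(-y)^{\operatorname{wt}'(T)},$$ over all super $n$-ribbon tableaux of shape $\lambda/\mu$; it is known not to depend on the chosen total order $\prec$. (The polynomial in $W/Z$ is the same with $W$ in place of $X$ and $Z$ in place of $Y$; its alphabets may have different sizes.) *)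

(* Defs.v *)
From HB Require Import structures.
From mathcomp Require Import all_boot all_order all_algebra.
From mathcomp Require Import finmap boolp.
From mathcomp Require Import mpoly.

Set Implicit Arguments.
Unset Strict Implicit.
Unset Printing Implicit Defensive.

Import GRing.Theory.

Local Open Scope fset_scope.

Definition is_part (lam : seq nat) : bool := sorted geq lam && (0 \notin lam).

Record intpart := IntPart { parts :> seq nat; _ : is_part parts }.

HB.instance Definition _ := [isSub for parts].
HB.instance Definition _ := [Countable of intpart by <:].

(* Boxes are pairs (row, column), counted from 0; rows are numbered from the
   top and columns from the left, so (i, j) lies directly above (i.+1, j). *)
Notation box := (nat * nat)%type.
Notation boxes := {fset box}.

Definition young (lam : intpart) : boxes :=
  [fset b in [seq (i, j) | i <- iota 0 (size lam), j <- iota 0 (nth 0 lam i)]].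

Lemma in_young (lam : intpart) i j :
  ((i, j) \in young lam) = (j < nth 0 lam i).
Proof.
rewrite inE; apply/allpairsPdep/idP => [[i' [j' [_ + [-> ->]]]]|ltj].
  by rewrite mem_iota.
exists i, j; rewrite !mem_iota /= ltj; split=> //.
by rewrite ltnNge; apply/negP => /(nth_default 0) lami; rewrite lami in ltj.
Qed.

Definition skew_shape (S : boxes) : Prop :=
  exists lam mu : intpart,
    young mu `<=` young lam /\ S = young lam `\` young mu.

Definition adjacent : rel box := fun b c =>
  [|| c == (b.1.+1, b.2), c == (b.1, b.2.+1),
      b == (c.1.+1, c.2) | b == (c.1, c.2.+1)].

Definition connected (S : boxes) : Prop :=
  {in S &, forall b c, exists2 p : seq box,
     path adjacent b p /\ {subset p <= S} & last b p = c}.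

Definition has_square (S : boxes) : Prop :=
  exists i j, [fset (i, j); (i, j.+1); (i.+1, j); (i.+1, j.+1)] `<=` S.

Definition ribbon (n : nat) (R : boxes) : Prop :=
  [/\ skew_shape R, connected R, #|` R| = n & ~ has_square R].

Definition ribbon_spin (R : boxes) : nat := #|` [fset b.1 | b in R]|.-1.

Definition removes_ribbon (n : nat) (lam mu : intpart) : Prop :=
  young mu `<=` young lam /\ ribbon n (young lam `\` young mu).

Definition is_core (n : nat) (delta : intpart) : Prop :=
  forall mu, ~ removes_ribbon n delta mu.

Inductive ribbon_removal (n : nat) : intpart -> intpart -> Prop :=
| ribbon_removal_refl lam : ribbon_removal n lam lam
| ribbon_removal_step lam mu nu :
    removes_ribbon n lam mu -> ribbon_removal n mu nu ->
    ribbon_removal n lam nu.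

(* The n-core of lam is delta: delta is reached from lam by removing n-ribbons
   until no further removal is possible (for n > 0 such a delta is unique). *)
Definition has_core (n : nat) (lam delta : intpart) : Prop :=
  ribbon_removal n lam delta /\ is_core n delta.

Definition cover (Q : {fset boxes}) : boxes := \bigcup_(R <- Q) R.

Definition tiling (n : nat) (S : boxes) (Q : {fset boxes}) : Prop :=
  [/\ {in Q, forall R, ribbon n R},
      {in Q &, forall R R', R != R' -> [disjoint R & R']%fset} &
      cover Q = S].

(* In a ribbon the topmost row and the rightmost column meet in a box of the
   ribbon, so every ribbon has exactly one top-right-most box. *)
Definition topright (R : boxes) (b : box) : Prop :=
  b \in R /\ {in R, forall c, b.1 <= c.1 /\ c.2 <= b.2}.

Definition horizontal_strip (n : nat) (S : boxes) (Q : {fset boxes}) : Prop :=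
  [/\ skew_shape S, tiling n S Q &
      {in Q, forall R i j, topright R (i.+1, j) -> (i, j) \notin S}].

Definition reflect_boxes (S : boxes) : boxes := [fset (b.2, b.1) | b in S].

Definition vertical_strip (n : nat) (S : boxes) (Q : {fset boxes}) : Prop :=
  horizontal_strip n (reflect_boxes S) [fset reflect_boxes R | R in Q].

(* Labels of A = {1..p} are [inl a], labels of A' = {1'..s'} are [inr b]. *)
Definition label_order (p s : nat) (le : rel ('I_p + 'I_s)) : Prop :=
  [/\ antisymmetric le, transitive le, total le,
      (forall a a' : 'I_p, le (inl a) (inl a') = (a <= a')) &
      (forall b b' : 'I_s, le (inr b) (inr b') = (b <= b'))].

(* A labelled set of ribbons; a ribbon R with label a is the pair (R, a). *)
Notation labelled_ribbons p s := {fset boxes * ('I_p + 'I_s)%type}.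

Definition ribbons_in (p s : nat) (T : labelled_ribbons p s)
    (P : pred ('I_p + 'I_s)) : {fset boxes} :=
  [fset t.1 | t in T & P t.2].

Record super_tableau (n p s : nat) (le : rel ('I_p + 'I_s))
    (lam mu : intpart) (T : labelled_ribbons p s) : Prop := SuperTableau {
  st_sub : young mu `<=` young lam;
  st_tiling : tiling n (young lam `\` young mu) (ribbons_in T predT);
  st_label : {in T &, forall t t', t.1 = t'.1 -> t.2 = t'.2};
  st_young : forall i, exists nu : intpart,
    young nu = young mu `|` cover (ribbons_in T (fun l => le l i));
  st_horizontal : forall a : 'I_p,
    let Q := ribbons_in T (pred1 (inl a)) in horizontal_strip n (cover Q) Q;
  st_vertical : forall b : 'I_s,
    let Q := ribbons_in T (pred1 (inr b)) in vertical_strip n (cover Q) Q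
}.

Definition super_tableaux (n p s : nat) (le : rel ('I_p + 'I_s))
    (lam mu : intpart) : {fset labelled_ribbons p s} :=
  [fset T in fpowerset
     (fpowerset (young lam `\` young mu) `*` [fset a | a : 'I_p + 'I_s])
   | `[< super_tableau n le lam mu T >]].

Lemma in_super_tableaux (n p s : nat) (le : rel ('I_p + 'I_s))
    (lam mu : intpart) (T : labelled_ribbons p s) :
  reflect (super_tableau n le lam mu T) (T \in super_tableaux n le lam mu).
Proof.
apply: (iffP idP); rewrite !inE /=; first by case/andP=> _ /asboolP.
move=> TT; apply/andP; split; last exact/asboolP.
rewrite fpowersetE; apply/fsubsetP=> -[R a] Ta.
rewrite inE /= fpowersetE; apply/andP; split; last by apply/imfsetP; exists a.
case: (st_tiling TT) => _ _ <-.
have TR : R \in ribbons_in T predT by apply/imfsetP; exists (R, a); rewrite ?inE ?Ta.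
exact: (bigfcup_sup id TR).
Qed.

Local Open Scope ring_scope.

Definition spin (p s : nat) (T : labelled_ribbons p s) : nat :=
  \sum_(t <- T) ribbon_spin t.1.

Definition wt (p s : nat) (T : labelled_ribbons p s) (a : 'I_p + 'I_s) : nat :=
  #|` [fset t in T | t.2 == a]|.

Definition superLLT (n p s : nat) (le : rel ('I_p + 'I_s)) (lam mu : intpart)
    (K : comNzRingType) (x : 'I_p -> K) (y : 'I_s -> K) (q : K) : K :=
  \sum_(T <- super_tableaux n le lam mu)
    q ^+ spin T * \prod_i x i ^+ wt T (inl i) * \prod_j (- y j) ^+ wt T (inr j).

(* Formal power series over R in commuting variables indexed by a finite type
   I, given by their coefficients. *)
Definition fps (I : finType) (R : Type) : Type := 'X_{1.. #|I|} -> R.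

Section FormalPowerSeries.

Variable I : finType.

HB.instance Definition _ (R : choiceType) := Choice.copy (fps I R)
  ('X_{1.. #|I|} -> R).

Section Additive.
Variable R : zmodType.
Implicit Types f g h : fps I R.

Definition fps_zero : fps I R := fun=> 0.
Definition fps_opp f : fps I R := fun m => - f m.
Definition fps_add f g : fps I R := fun m => f m + g m.

Fact fps_addA : associative fps_add.
Proof. by move=> f g h; apply/funext => m; apply: addrA. Qed.
Fact fps_addC : commutative fps_add.
Proof. by move=> f g; apply/funext => m; apply: addrC. Qed.
Fact fps_add0 : left_id fps_zero fps_add.
Proof. by move=> f; apply/funext => m; apply: add0r. Qed.
Fact fps_addN : left_inverse fps_zero fps_opp fps_add.
Proof. by move=> f; apply/funext => m; apply: addNr. Qed.

HB.instance Definition _ := GRing.isZmodule.Build (fps I R)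
  fps_addA fps_addC fps_add0 fps_addN.

Lemma fps_coef0 m : (0 : fps I R) m = 0. Proof. by []. Qed.
Lemma fps_coefN f m : (- f) m = - f m. Proof. by []. Qed.
Lemma fps_coefD f g m : (f + g) m = f m + g m. Proof. by []. Qed.
Lemma fps_coefB f g m : (f - g) m = f m - g m. Proof. by []. Qed.
Lemma fps_coef_sum J (r : seq J) (P : pred J) (F : J -> fps I R) m :
  (\sum_(j <- r | P j) F j) m = \sum_(j <- r | P j) F j m.
Proof. by elim/big_rec2: _ => // j x y _ <-. Qed.

End Additive.

Section Ring.
Variable R : comNzRingType.
Implicit Types f g h : fps I R.

Definition fpsC (c : R) : fps I R := fun m => if m == 0%MM then c else 0.

Definition fpsX (i : I) : fps I R := fun m => (m == U_(enum_rank i)%MM)%:R.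

Definition fps_mul f g : fps I R := fun m =>
  \sum_(k : 'X_{1.. #|I| < (mdeg m).+1, (mdeg m).+1} | m == (k.1 + k.2)%MM)
    f k.1 * g k.2.

Definition fps_trunc d f : {mpoly R[#|I|]} :=
  \sum_(m : 'X_{1.. #|I| < d}) f m *: 'X_[m].

Lemma fps_truncE d f m : (mdeg m < d)%N -> (fps_trunc d f)@_m = f m.
Proof. exact: mcoeff_mpoly. Qed.

Lemma eq_mcoeffM (p p' r r' : {mpoly R[#|I|]}) m :
    (forall k, (mdeg k <= mdeg m)%N -> p@_k = p'@_k) ->
    (forall k, (mdeg k <= mdeg m)%N -> r@_k = r'@_k) ->
  (p * r)@_m = (p' * r')@_m.
Proof.
move=> eqp eqr; rewrite !mcoeffM; apply: eq_bigr => -[k1 k2] _.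
by rewrite eqp ?eqr //= -ltnS bmdeg.
Qed.

Lemma fps_mulE d f g m : (mdeg m < d)%N ->
  fps_mul f g m = (fps_trunc d f * fps_trunc d g)@_m.
Proof.
move=> ltd; rewrite mcoeffM; apply: eq_bigr => -[k1 k2] _ /=.
by rewrite !fps_truncE // (leq_trans (bmdeg _)).
Qed.

Fact fps_mulA : associative fps_mul.
Proof.
move=> f g h; apply/funext => m; pose d := (mdeg m).+1.
rewrite !(@fps_mulE d) //.
transitivity (fps_trunc d f * (fps_trunc d g * fps_trunc d h))@_m.
  by apply: eq_mcoeffM => // k lek; rewrite fps_truncE // (@fps_mulE d).
rewrite mulrA.
by apply: eq_mcoeffM => // k lek; rewrite fps_truncE // (@fps_mulE d).
Qed.

Fact fps_mulC : commutative fps_mul.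
Proof.
by move=> f g; apply/funext => m; rewrite !(@fps_mulE (mdeg m).+1) // mulrC.
Qed.

Fact fps_mul1 : left_id (fpsC 1) fps_mul.
Proof.
move=> f; apply/funext => m; pose d := (mdeg m).+1.
rewrite (@fps_mulE d) // -[RHS](@fps_truncE d) // -[in RHS](mul1r (fps_trunc _ _)).
apply: eq_mcoeffM => // k lek; rewrite fps_truncE // mcoeff1 /fpsC.
by case: (k == _).
Qed.

Fact fps_mulD : left_distributive fps_mul +%R.
Proof.
move=> f g h; apply/funext => m; rewrite fps_coefD -big_split /=.
by apply: eq_bigr => k _; rewrite fps_coefD mulrDl.
Qed.

Fact fps_1neq0 : fpsC 1 != 0.
Proof.
by apply/eqP => /(congr1 (fun f => f 0%MM)) /eqP; rewrite /fpsC eqxx oner_eq0.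
Qed.

HB.instance Definition _ := GRing.Zmodule_isComNzRing.Build (fps I R)
  fps_mulA fps_mulC fps_mul1 fps_mulD fps_1neq0.

Lemma fps_coefM f g m : (f * g) m =
  \sum_(k : 'X_{1.. #|I| < (mdeg m).+1, (mdeg m).+1} | m == (k.1 + k.2)%MM)
    f k.1 * g k.2.
Proof. by []. Qed.

Lemma fps_coef1 m : (1 : fps I R) m = (m == 0%MM)%:R.
Proof. by rewrite /GRing.one /= /fpsC; case: eqP. Qed.

Lemma fps_coefM0 f g : (f * g) 0%MM = f 0%MM * g 0%MM.
Proof.
rewrite [LHS](@fps_mulE 1) ?mdeg0 // -[in RHS](@fps_truncE 1 f) ?mdeg0 //.
by rewrite -[in RHS](@fps_truncE 1 g) ?mdeg0 // -rmorphM.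
Qed.

Lemma fps_coefCM c f m : (fpsC c * f) m = c * f m.
Proof.
rewrite [LHS](@fps_mulE (mdeg m).+1) // -[in RHS](@fps_truncE (mdeg m).+1 f) //.
rewrite -mcoeffCM; apply: eq_mcoeffM => // k lek; rewrite fps_truncE // mcoeffC.
by rewrite /fpsC; case: eqP; rewrite ?mulr1 ?mulr0.
Qed.

Lemma fps_coefX_lt f k m : f 0%MM = 0 -> (mdeg m < k)%N -> (f ^+ k) m = 0.
Proof.
move=> f0; elim: k m => // k IHk m ltm; rewrite exprS fps_coefM big1 // => -[a b].
move=> /= /eqP mE; have [->|a0] := eqVneq (a : 'X_{1.. _}) 0%MM.
  by rewrite f0 mul0r.
rewrite IHk ?mulr0 // -ltnS; apply: leq_ltn_trans ltm.
have dm : mdeg m = (mdeg a + mdeg b)%N by rewrite -mdegD -mE.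
apply: leq_trans (eq_leq (esym dm)).
by rewrite -[X in (X < _)%N]add0n ltn_add2r lt0n mdeg_eq0.
Qed.

(* 1 / (1 - f) = 1 + f + f^2 + ..., meaningful if f has zero constant term. *)
Definition fps_geom f : fps I R :=
  fun m => (\sum_(k < (mdeg m).+1) f ^+ k) m.

Lemma fps_geomE d f m : f 0%MM = 0 -> (mdeg m < d)%N ->
  fps_geom f m = (\sum_(k < d) f ^+ k) m.
Proof.
move=> f0 /subnKC <-; rewrite /fps_geom big_split_ord /= fps_coefD.
rewrite [X in _ + X]fps_coef_sum [X in _ + X]big1 ?addr0 // => k _.
by rewrite fps_coefX_lt // ltnS leq_addr.
Qed.

Lemma fps_geomP f : f 0%MM = 0 -> (1 - f) * fps_geom f = 1.
Proof.
move=> f0; apply/funext => m; pose d := (mdeg m).+1.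
transitivity (((1 - f) * \sum_(k < d) f ^+ k) m).
  rewrite !fps_coefM; apply: eq_bigr => -[a b] /= /eqP mE.
  by rewrite -(fps_geomE f0) // bmdeg.
by rewrite -[1 - f]opprB mulNr -subrX1 opprB fps_coefB fps_coefX_lt ?subr0.
Qed.

End Ring.

Section UnitRing.
Variable R : comUnitRingType.
Implicit Types f g : fps I R.

Definition fps_unit : {pred fps I R} := fun f => f 0%MM \is a GRing.unit.

Definition fps_inv f : fps I R :=
  if fps_unit f then
    let c := (f 0%MM)^-1 in fpsC c * fps_geom (1 - fpsC c * f)
  else f.

Fact fps_mulVx : {in fps_unit, left_inverse 1 fps_inv *%R}.
Proof.
move=> f Uf; rewrite /fps_inv (_ : fps_unit f = true) //=.
rewrite mulrAC -{1}[fpsC _ * f](subKr 1) fps_geomP //.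
by rewrite fps_coefB fps_coefCM fps_coef1 eqxx mulVr // subrr.
Qed.

Fact fps_unitPl f g : g * f = 1 -> fps_unit f.
Proof.
move=> /(congr1 (fun h => h 0%MM)); rewrite fps_coefM0 fps_coef1 eqxx => gf1.
by apply/unitrPr; exists (g 0%MM); rewrite mulrC.
Qed.

Fact fps_inv_out : {in [predC fps_unit], fps_inv =1 id}.
Proof. by move=> f /negPf Uf; rewrite /fps_inv (_ : fps_unit f = false). Qed.

HB.instance Definition _ := GRing.ComNzRing_hasMulInverse.Build (fps I R)
  fps_mulVx fps_unitPl fps_inv_out.

End UnitRing.

End FormalPowerSeries.

(* Sum of a possibly infinite, locally finite family of power series: for each
   monomial m all but finitely many coefficients at m vanish. *)
Definition fps_has_sum (I : finType) (R : comNzRingType) (J : eqType)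
    (P : J -> Prop) (F : J -> fps I R) (S : fps I R) : Prop :=
  forall m, exists r : seq J,
    [/\ uniq r, (forall j, j \in r -> P j),
        (forall j, P j -> j \notin r -> F j m = 0) &
        \sum_(j <- r) F j m = S m].

(* Main.v *)
(* Encode a partition by its beads: the row of index i carries a bead at
   lam_i - i. Adding an n-ribbon moves a bead from b to b + n, with spin the
   number of beads jumped over; let u_b be this operator, weighted by q^spin, and
   d_b its transpose. Horizontal strips are the terms of the product of the
   1 + x u_b applied for increasing b, vertical strips those for decreasing b, so
   a super tableau generating function is a matrix entry of a product of such
   sweeps, one for each label.
   The operators u_b and d_c commute for b <> c, and on the sites b, b + n
   there is a two by two Gauss decomposition
     (1 + y d_b) f(M_(b+1)) (1 + x u_b) = (1 + x u_b) f(M_b) (1 + y d_b),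
   where M_b counts the beads in [b, b + n) and
   f(N + 1) (1 - x y q^(2N)) = f(N). Multiplying over all b, a sweep of d's passes
   a sweep of u's at the cost of f(n) / f(0), as M_b is n far to the left and 0 far
   to the right; three similar relations treat the other pairs of sweeps.
   Finally a core is annihilated by every d_b, so only the scalars remain. This
   holds for any order of the labels. Sums are made finite by working in a large
   window of sites, up to terms of high degree. *)
Require Import Defs.
From mathcomp Require Import all_boot all_order all_algebra finmap mpoly.
From mathcomp Require Import boolp zify ring.
Require Import Defs.
Import Order.TTheory GRing.Theory Num.Theory.
Set Implicit Arguments.
Unset Strict Implicit.
Unset Printing Implicit Defensive.
Local Open Scope fset_scope.
Local Open Scope nat_scope.

(** * Young diagrams and ribbons *)

Section Diagrams.
Implicit Types (S : boxes) (i j k l : nat).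

(** Tableaux are unordered sets of ribbons under geometric conditions, whereas a sweep is an ordered
    product of local moves. Two facts bridge the gap: the last ribbon of a tableau can be peeled off
    leaving a tableau, and a ribbon is determined by its label and the content of its bottom-left
    box. Hence a tableau amounts to a subset of the ordered list of pairs (label, site) along which
    every move is possible. The delicate point is geometric: in a horizontal strip the ribbon of
    largest tail content lies on the outer rim.

    The scalar f(M_b) comes from the failure of d_b and u_b to commute. On the two configurations
    with one bead on the sites b, b + n they are strictly triangular matrices of opposite kinds, and
    exchanging the unipotent factors costs a diagonal matrix depending on the number N of beads in
    between. The counts (M_b, M_(b+1)) are (N + 1, N) on one configuration and (N, N + 1) on the
    other, so the diagonal matrix left over at one site is exactly the one wanted at the next.

    The truncation rests on each u carrying a variable: a state out of reach of k added ribbons only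
    has terms of degree above k. *)

Definition ideal (S : boxes) := forall i j,
  ((i.+1, j) \in S -> (i, j) \in S) /\ ((i, j.+1) \in S -> (i, j) \in S).

Lemma ideal_le S i j i' j' : ideal S -> (i, j) \in S -> i' <= i -> j' <= j ->
  (i', j') \in S.
Proof.
move=> idS Sij lei lej.
have {Sij} : (i', j) \in S.
  rewrite -(subnK lei) in Sij; elim: (i - i') Sij => // k IHk; rewrite addSn.
  by move=> /(idS _ _).1; apply: IHk.
rewrite -{1}(subnK lej); elim: (j - j') => // k IHk; rewrite addSn.
by move=> /(idS _ _).2; apply: IHk.
Qed.

Lemma nth_part (lam : intpart) i j : i <= j -> nth 0 lam j <= nth 0 lam i.
Proof.
case: lam => s /= /andP[ss _] ij.
case: (ltnP j (size s)) => [ltj|?]; last by rewrite (nth_default 0).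
apply: (sorted_leq_nth (leT := geq)) => //; first by move=> a b c /= ba ac; apply: leq_trans ac ba.
  by move=> a; exact: leqnn.
exact: leq_ltn_trans ij ltj.
Qed.

Lemma young_ideal lam : ideal (young lam).
Proof.
move=> i j; rewrite !in_young; split=> [lt|/ltnW//].
by apply: leq_trans lt _; apply: nth_part.
Qed.

Lemma young_inj : injective young.
Proof.
move=> lam mu eqy.
have eqn i : nth 0 lam i = nth 0 mu i.
  have H j : (j < nth 0 lam i) = (j < nth 0 mu i) by rewrite -!in_young eqy.
  by apply/eqP; rewrite eqn_leq leqNgt H ltnn leqNgt -H ltnn.
have szP (s : intpart) i : (i < size s) = (0 < nth 0 s i).
  case: (ltnP i (size s)) => [lti|/(nth_default 0)->//].
  case: s lti => s /= /andP[_ s0] lti; rewrite lt0n; apply/esym/negP => /eqP si.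
  by move/negP: s0; apply; rewrite -si mem_nth.
apply: val_inj; apply: (@eq_from_nth _ 0) => //.
have H i : (i < size lam) = (i < size mu) by rewrite !szP eqn.
by apply/eqP; rewrite eqn_leq leqNgt H ltnn leqNgt -H ltnn.
Qed.

Lemma boxes_bounded (S : boxes) : exists B, forall i j, (i, j) \in S -> i < B /\ j < B.
Proof.
exists (\max_(b <- S) maxn b.1 b.2).+1 => i j Sij; rewrite !ltnS.
have := @leq_bigmax_seq _ (enum_fset S) xpredT (fun b => maxn b.1 b.2) _ Sij isT.
by rewrite /= geq_max => /andP[].
Qed.

Lemma ideal_young S : ideal S -> exists lam, young lam = S.
Proof.
move=> idS; have [B ltB] := boxes_bounded S.
have exr i : exists j, (i, j) \notin S.
  by exists B; apply/negP => /ltB []; rewrite ltnn.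
pose r i := ex_minn (exr i).
have rP i j : (j < r i) = ((i, j) \in S).
  rewrite /r; case: ex_minnP => m mS minm; apply/idP/idP => [ltm|ijS].
    by apply: contraTT ltm => ijS; rewrite -leqNgt minm.
  rewrite ltnNge; apply: contra mS => lem; exact: ideal_le ijS _ lem.
have exl : exists i, r i == 0.
  by exists B; rewrite -leqn0 leqNgt rP; apply/negP => /ltB []; rewrite ltnn.
pose l := ex_minn exl.
have lP i : (i < l) = (0 < r i).
  rewrite /l; case: ex_minnP => m /eqP mS minm; apply/idP/idP => [ltm|ri].
    by rewrite lt0n; apply: contraTN ltm => /minm; rewrite -leqNgt.
  rewrite ltnNge; apply/negP => lem; move: ri; rewrite rP => ri.
  by have := ideal_le idS ri lem (leqnn 0); rewrite -rP mS.
have pP : is_part (mkseq r l).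
  apply/andP; split; last first.
    by apply/mapP => -[i]; rewrite mem_iota /= add0n lP => + r0; rewrite -r0.
  apply/(sortedP 0) => i; rewrite size_mkseq => lti.
  rewrite !nth_mkseq // ?(ltnW lti) //= leqNgt rP; apply/negP => /(idS _ _).1.
  by rewrite -rP ltnn.
exists (IntPart pP); apply/fsetP => -[i j]; rewrite in_young /= -rP.
case: (ltnP i l) => lti; first by rewrite nth_mkseq.
rewrite nth_default ?size_mkseq //; apply/esym.
by rewrite ltnNge (leq_trans _ (leq0n _)) // leqNgt -lP -leqNgt.
Qed.

Definition content (b : box) : int := (b.2%:Z - b.1%:Z)%R.

Definition convex (S : boxes) := forall i j i' j' a b,
  (i, j) \in S -> (i', j') \in S -> i <= a <= i' -> j <= b <= j' -> (a, b) \in S.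

Lemma skew_convex S : skew_shape S -> convex S.
Proof.
move=> [lam [mu [_ ->]]] i j i' j' a b; rewrite !in_fsetD.
move=> /andP[mij lij] /andP[_ lij'] /andP[ia ai] /andP[jb bj]; apply/andP; split.
  by apply: contra mij => mab; apply: ideal_le mab _ _ => //; exact: young_ideal.
by apply: ideal_le lij' _ _ => //; exact: young_ideal.
Qed.

Lemma card_imfset_seq (T T' : choiceType) (f : T -> T') (s : seq T) : uniq s ->
  {in s &, injective f} -> #|` [fset f x | x in s]| = size s.
Proof.
move=> us injf; by rewrite card_in_imfset //= undup_id.
Qed.

Lemma seq_min (T : eqType) (f : T -> int) (s : seq T) x0 : x0 \in s ->
  exists2 x, x \in s & {in s, forall y, (f x <= f y)%R}.
Proof.
elim: s x0 => // a s IHs x0 _; case: s IHs => [_|b s IHs].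
  by exists a; rewrite ?mem_head // => y; rewrite inE => /eqP ->.
have [x xs minx] := IHs b (mem_head _ _).
have [le|lt] := lerP (f a) (f x).
  exists a; rewrite ?mem_head // => y; rewrite inE => /orP[/eqP->//|/minx]; lia.
exists x; first by rewrite inE xs orbT.
move=> y; rewrite inE => /orP[/eqP->|/minx//]; lia.
Qed.

Section Ribbon.
Variable n : nat.
(* For a ribbon with n boxes, m is the content of its bottom-left box. *)
Definition tail_at (S : boxes) (m : int) :=
  forall k : int, (exists2 b, b \in S & content b = k) <-> (m <= k < m + n%:Z)%R.

Section OneRibbon.
Variable R : boxes.
Hypothesis ribR : ribbon n R.

Lemma ribbon_convex : convex R.
Proof. by case: ribR => /skew_convex. Qed.

(** By convexity two boxes on one diagonal would span a 2x2 square. So a ribbon has at most one box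
    of each content. *)
Lemma ribbon_diag i j k : (i, j) \in R -> (i + k, j + k) \in R -> k = 0.
Proof.
case: ribR => skR _ _ nsq; case: k => // k Rij Rijk; case: nsq; exists i, j.
have cR := ribbon_convex.
apply/fsubsetP => x; rewrite !inE => /orP[/orP[/orP[]|]|] /eqP ->;
  apply: (cR _ _ _ _ _ _ Rij Rijk); lia.
Qed.

Lemma ribbon_content_inj b c : b \in R -> c \in R -> content b = content c -> b = c.
Proof.
case: b c => [i j] [k l] Rb Rc; rewrite /content /= => eqc.
have [le|le] := leqP i k.
  have H : k - i = 0.
    apply: (@ribbon_diag i j) => //.
    by have [-> ->] : i + (k - i) = k /\ j + (k - i) = l by lia.
  by congr pair; lia.
have H : i - k = 0.
  apply: (@ribbon_diag k l) => //.
  by have [-> ->] : k + (i - k) = i /\ l + (i - k) = j by lia.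
by congr pair; lia.
Qed.

Lemma adjacent_content b c : adjacent b c ->
  (content c = content b + 1 \/ content b = content c + 1)%R.
Proof.
case: b c => [i j] [k l]; rewrite /adjacent /content /=.
by do ?case/orP; move=> /eqP [-> ->]; lia.
Qed.

(** Contents change by one along a path of adjacent boxes, so no value is skipped. *)
Lemma ribbon_between b c (k : int) : b \in R -> c \in R -> (content b <= k <= content c)%R ->
  exists2 d, d \in R & content d = k.
Proof.
move=> Rb Rc; case: ribR => _ /(_ b c Rb Rc) [p [+ +] <-] _ _ {c Rc}.
elim: p b Rb => [|c p IHp] b Rb /=.
  by move=> _ _ kE; exists b => //; lia.
move=> /andP[/adjacent_content adj pp] sub kE.
have [<-|nk] := eqVneq (content b) k; first by exists b.
apply: (IHp c) => //.
- by apply: sub; rewrite mem_head.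
- by move=> x px; apply: sub; rewrite in_cons px orbT.
- lia.
Qed.

Lemma topright_content b : topright R b -> {in R, forall c, (content c <= content b)%R}.
Proof. by move=> [_ top] c /top; rewrite /content; lia. Qed.

Lemma content_topright b : b \in R -> {in R, forall c, (content c <= content b)%R} -> topright R b.
Proof.
case: b => i j Rb maxb; split=> // -[k l] Rc; have := maxb _ Rc; rewrite /content /= => lec.
case: (leqP i k) => [ik|ki]; case: (leqP l j) => [lj|jl] //; exfalso.
- have := @ribbon_diag i j 1 Rb; rewrite !addn1 => H.
  by suff: 1 = 0 by []; apply: H; apply: (ribbon_convex Rb Rc); lia.
- have := @ribbon_diag i.-1 j.-1 1; rewrite !addn1.
  have [-> ->] : i.-1.+1 = i /\ j.-1.+1 = j by lia.
  by move=> H; suff: 1 = 0 by []; apply: H => //; apply: (ribbon_convex Rc Rb); lia.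
- lia.
Qed.

(** A box of that content further up or down would, by convexity, force a second box onto an
    occupied diagonal. The equation [i = i.-1.+1] records that row [i] is not the top row. *)
Lemma ribbon_next i j b : (i, j) \in R -> b \in R -> (content b = content (i, j) + 1)%R ->
  b = (i, j.+1) \/ i = i.-1.+1 /\ b = (i.-1, j).
Proof.
case: b => k l Rb Rc; rewrite /content /= => cE.
have [ik|ik] := ltnP i k.
  have := @ribbon_diag i j 1 Rb; rewrite !addn1 => H.
  by suff: 1 = 0 by []; apply: H; apply: (ribbon_convex Rb Rc); lia.
have [ki|ki] := ltnP k i.-1.
  have := @ribbon_diag k l 1 Rc; rewrite !addn1 => H.
  by suff: 1 = 0 by []; apply: H; apply: (ribbon_convex Rc Rb); lia.
have [kE|kE] := eqVneq k i; first by left; congr pair; lia.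
by right; split; [lia|congr pair; lia].
Qed.

End OneRibbon.

(** The contents form an interval by connectedness; as they are distinct, its length is the number
    [n] of boxes. *)
Lemma ribbon_tail_at R : 0 < n -> ribbon n R -> exists m, tail_at R m.
Proof.
move=> n_gt0 ribR.
have cardR : #|` R| = n by case: ribR.
have [R0|[b0 Rb0]] := fset_0Vmem R; first by move: n_gt0; rewrite -cardR R0 cardfs0.
have [b Rb minb] := seq_min content Rb0.
have [c Rc maxc] := seq_min (fun x => - content x)%R Rb0.
have [N NE] : exists N : nat, (content c - content b = N%:Z - 1)%R.
  by exists `|content c - content b|.+1; have := minb c Rc; lia.
have imE : [fset content x | x in R] = [fset (content b + k%:Z)%R | k in iota 0 N].
  apply/fsetP => k; apply/imfsetP/imfsetP => -[].
    move=> x Rx ->; exists `|content x - content b|; rewrite ?mem_iota;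
    have := minb x Rx; have /= := maxc x Rx; lia.
  move=> j; rewrite mem_iota => jN ->.
  have [|d Rd dE] := ribbon_between ribR Rb Rc (k := (content b + j%:Z)%R); first by lia.
  by exists d.
have := congr1 (fun X => #|` X|) imE => /=.
rewrite card_in_imfset; last by move=> x y; apply: (ribbon_content_inj ribR).
rewrite cardR card_imfset_seq ?iota_uniq //; last by move=> x y _ _ /= xy; lia.
rewrite size_iota => nN.
exists (content b) => k; split=> [[x Rx <-]|kE].
  by have := minb x Rx; have /= := maxc x Rx; lia.
by apply: (ribbon_between ribR Rb Rc); lia.
Qed.

End Ribbon.

End Diagrams.

Lemma coverP (Q : {fset boxes}) b :
  reflect (exists2 R, R \in Q & b \in R) (b \in cover Q).
Proof.
apply: (iffP (bigfcupP _ _ _ _)) => [[R]|[R QR Rb]]; first by rewrite andbT; exists R.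
by exists R; rewrite ?QR.
Qed.

(** * Ribbon strips *)

Section Strips.
Variable n : nat.
Hypothesis n_gt0 : 0 < n.
Implicit Types (S R : boxes) (Q : {fset boxes}) (m : int) (b c : box) (i j k : nat).
Notation tail_at := (tail_at n).

Lemma tail_at_min R m : tail_at R m -> exists2 b, b \in R & content b = m.
Proof. by move=> /(_ m) [_]; apply; lia. Qed.

Lemma tail_at_max R m : tail_at R m -> exists2 b, b \in R & content b = (m + n%:Z - 1)%R.
Proof. by move=> /(_ (m + n%:Z - 1)%R) [_]; apply; lia. Qed.

Lemma tail_at_bound R m b : tail_at R m -> b \in R -> (m <= content b < m + n%:Z)%R.
Proof. by move=> /(_ (content b)) [tR _] Rb; apply: tR; exists b. Qed.

Lemma tail_at_uniq R m m' : tail_at R m -> tail_at R m' -> m = m'.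
Proof.
move=> tm tm'; have [b Rb bE] := tail_at_min tm; have [b' Rb' bE'] := tail_at_min tm'.
by have := tail_at_bound tm Rb'; have := tail_at_bound tm' Rb; lia.
Qed.

Lemma ribbon_neq0 R : ribbon n R -> exists b, b \in R.
Proof. by move=> /(ribbon_tail_at n_gt0) [m /tail_at_min [b Rb _]]; exists b. Qed.

Section Tiling.
Variables (S : boxes) (Q : {fset boxes}).
Hypothesis tilQ : tiling n S Q.

Lemma tiling_ribbon R : R \in Q -> ribbon n R.
Proof. by case: tilQ => rQ _ _; apply: rQ. Qed.

Lemma tiling_eq R R' b : R \in Q -> R' \in Q -> b \in R -> b \in R' -> R = R'.
Proof.
case: tilQ => _ disQ _ QR QR' Rb R'b; apply/eqP/negPn/negP => neq.
by have /fdisjointP/(_ b Rb) := disQ _ _ QR QR' neq; rewrite R'b.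
Qed.

Lemma tiling_sub R b : R \in Q -> b \in R -> b \in S.
Proof. by case: tilQ => _ _ <- QR Rb; apply/coverP; exists R. Qed.

Lemma tiling_mem b : b \in S -> exists2 R, R \in Q & b \in R.
Proof. by case: tilQ => _ _ <- /coverP. Qed.

Lemma tiling_del R : R \in Q -> tiling n (S `\` R) (Q `\ R).
Proof.
move=> QR; split.
- by move=> R'; rewrite !inE => /andP[_ /tiling_ribbon].
- move=> R1 R2; rewrite !inE => /andP[_ Q1] /andP[_ Q2]; by case: tilQ => _ + _; apply.
apply/fsetP => b; rewrite !inE; apply/coverP/andP.
  move=> [R']; rewrite !inE => /andP[neq QR'] R'b; split; last exact: tiling_sub R'b.
  by apply: contra neq => Rb; rewrite (tiling_eq QR' QR R'b Rb).
move=> [nRb /tiling_mem [R' QR' R'b]]; exists R' => //; rewrite !inE QR' andbT.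
by apply: contraNneq nRb => <-.
Qed.

Lemma tiling_add R : ribbon n R -> [disjoint R & S]%fset -> tiling n (S `|` R) (R |` Q).
Proof.
move=> ribR /fdisjointP dis.
have disQ R' b : R' \in Q -> b \in R -> b \in R' -> False.
  by move=> QR' /dis /negP nS R'b; apply: nS; apply: tiling_sub R'b.
split.
- by move=> R'; rewrite !inE => /orP[/eqP->|/tiling_ribbon].
- move=> R1 R2; rewrite !inE => /orP[/eqP->|Q1] /orP[/eqP->|Q2]; rewrite ?eqxx // => neq.
  + by apply/fdisjointP => b Rb; apply/negP; apply: disQ Rb.
  + by apply/fdisjointP => b R1b; apply/negP => Rb; apply: disQ Q1 Rb R1b.
  + by case: tilQ => _ + _; apply.
apply/fsetP => b; rewrite !inE; apply/coverP/orP.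
  move=> [R']; rewrite !inE => /orP[/eqP->|QR'] R'b; [by right|left; exact: tiling_sub R'b].
case=> [/tiling_mem [R' QR' R'b]|Rb]; last by exists R; rewrite ?inE ?eqxx.
by exists R' => //; rewrite !inE QR' orbT.
Qed.

End Tiling.

Section Horizontal.
Variables (S : boxes) (Q : {fset boxes}).
Hypothesis horQ : horizontal_strip n S Q.

Let tilQ : tiling n S Q. Proof. by case: horQ. Qed.
Let convS : convex S. Proof. by case: horQ => /skew_convex. Qed.

(** By convexity such a box of [S] would force the box directly above the head of [R] into [S],
    against the strip condition. *)
Lemma horizontal_head R i j (i' j' : nat) : R \in Q -> (i, j) \in R ->
  {in R, forall c, (content c <= content (i, j))%R} -> (i', j') \in S -> i' < i -> j' <= j -> False.
Proof.
move=> QR Rij maxR Sij' ltii lejj; case: horQ => _ _ /(_ R QR i.-1 j).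
have iE : i.-1.+1 = i by lia.
rewrite iE => /(_ (content_topright (tiling_ribbon tilQ QR) Rij maxR)) /negP; apply.
by apply: (convS Sij' (tiling_sub tilQ QR Rij)); lia.
Qed.

(** The heads would lie on one diagonal, and the lower one would have a box of the strip above and
    to its left. This is why a label and a tail content determine a ribbon of a tableau. *)
Lemma horizontal_uniq R R' m : R \in Q -> R' \in Q -> tail_at R m -> tail_at R' m -> R = R'.
Proof.
move=> QR QR' tm tm'.
have [[i j] Rb bE] := tail_at_max tm; have [[i' j'] Rb' bE'] := tail_at_max tm'.
have maxR : {in R, forall c, (content c <= content (i, j))%R}.
  by move=> c /(tail_at_bound tm); lia.
have maxR' : {in R', forall c, (content c <= content (i', j'))%R}.
  by move=> c /(tail_at_bound tm'); lia.
have eqc : (j%:Z - i%:Z = j'%:Z - i'%:Z)%R by move: bE bE'; rewrite /content /=; lia.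
have [lti|lti|eqi] := ltngtP i i'.
- by exfalso; apply: (horizontal_head QR' Rb' maxR' (tiling_sub tilQ QR Rb)); lia.
- by exfalso; apply: (horizontal_head QR Rb maxR (tiling_sub tilQ QR' Rb')); lia.
- apply: (tiling_eq tilQ QR QR' Rb); by have -> : (i, j) = (i', j') by congr pair; lia.
Qed.

Variables (R : boxes) (m : int).
Hypotheses (QR : R \in Q) (tR : tail_at R m).
Hypothesis lastR : forall R' m', R' \in Q -> R' <> R -> tail_at R' m' -> (m' < m)%R.

(* A ribbon R' passing below R stays below it up to the head of R', which would
   then have a box of the strip above it. *)
Lemma horizontal_no_cross R' i j k : R' \in Q -> R' <> R -> (i, j) \in R ->
  (i + k, j + k) \in R' -> k = 0.
Proof.
move=> QR' neq; have ribR := tiling_ribbon tilQ QR; have ribR' := tiling_ribbon tilQ QR'.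
have [m' tR'] := ribbon_tail_at n_gt0 ribR'; have ltm := lastR QR' neq tR'.
move=> Rij; have [N NE] : exists N : nat,
    (content (i, j) + N%:Z = m' + n%:Z - 1)%R \/ (m' + n%:Z - 1 < content (i, j))%R.
  by exists `|(m' + n%:Z - 1 - content (i, j))%R|%N; lia.
elim: N i j k Rij NE => [|N IHN] i j k Rij NE R'ij; case: (posnP k) => // k0; exfalso.
  have ctE : content (i + k, j + k) = content (i, j) by rewrite /content /=; lia.
  have b1 := tail_at_bound tR' R'ij.
  apply: (horizontal_head QR' R'ij _ (tiling_sub tilQ QR Rij)); try lia.
  by move=> c /(tail_at_bound tR'); lia.
have ctE : content (i + k, j + k) = content (i, j) by rewrite /content /=; lia.
have b1 := tail_at_bound tR' R'ij; have b2 := tail_at_bound tR Rij.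
have [E|nE] := eqVneq (content (i, j)) (m' + n%:Z - 1)%R.
  apply: (horizontal_head QR' R'ij _ (tiling_sub tilQ QR Rij)).
  - by move=> c /(tail_at_bound tR'); lia.
  - lia.
  - lia.
have [b Rb bE] : exists2 b, b \in R & content b = (content (i, j) + 1)%R by apply/tR; lia.
have [b' Rb' bE'] : exists2 b, b \in R' & content b = (content (i, j) + 1)%R by apply/tR'; lia.
have nb := ribbon_next ribR Rij Rb bE.
have nb' := ribbon_next ribR' R'ij Rb'; rewrite bE' ctE in nb'; have {}nb' := nb' erefl.
case: b Rb bE nb => bi bj Rb bE nb; case: b' Rb' bE' nb' => bi' bj' Rb' bE' nb'.
have [eqb|neqb] := eqVneq (bi, bj) (bi', bj').
  by apply: neq; apply: (tiling_eq tilQ QR' QR Rb'); rewrite -eqb.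
have H : bi < bi' /\ bj' = bj + (bi' - bi).
  have : bi <> bi' \/ bj <> bj'.
    by move: neqb; rewrite xpair_eqE negb_and => /orP[/eqP|/eqP]; [left|right].
  by case: nb nb' => [[? ?]|[? [? ?]]] [[? ?]|[? [? ?]]]; lia.
have := IHN bi bj (bi' - bi) Rb; have -> : bi + (bi' - bi) = bi' by lia.
rewrite -H.2 => /(_ _ Rb') H'.
suff: bi' - bi = 0 by lia.
by apply: H'; move: NE bE; rewrite /content /=; lia.
Qed.

(** This makes the last ribbon removable. A neighbour in another ribbon [R'] would place a box of
    [R'] diagonally below a box of [R], excluded by [horizontal_no_cross], or be the head of [R']
    with a box of the strip above it. *)
Lemma horizontal_rim i j : (i, j) \in R ->
  ((i, j.+1) \in S -> (i, j.+1) \in R) /\ ((i.+1, j) \in S -> (i.+1, j) \in R).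
Proof.
move=> Rij; have ribR := tiling_ribbon tilQ QR.
split=> /(tiling_mem tilQ) [R' QR' R'b].
  have [<-//|/eqP neq] := eqVneq R' R; exfalso.
  have [m' tR'] := ribbon_tail_at n_gt0 (tiling_ribbon tilQ QR').
  have ltm := lastR QR' neq tR'.
  have b1 := tail_at_bound tR' R'b; have b2 := tail_at_bound tR Rij.
  have [b Rb bE] : exists2 b, b \in R & content b = (content (i, j) + 1)%R.
    by apply/tR; move: b1 b2; rewrite /content /=; lia.
  case: (ribbon_next ribR Rij Rb bE) => [E|[E bE']].
    by apply: neq; apply: (tiling_eq tilQ QR' QR R'b); rewrite -E.
  have := @horizontal_no_cross R' i.-1 j 1 QR' neq; rewrite -bE' !addn1 -E => /(_ Rb R'b).
  by [].
have [<-//|/eqP neq] := eqVneq R' R; exfalso.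
have [m' tR'] := ribbon_tail_at n_gt0 (tiling_ribbon tilQ QR').
have ltm := lastR QR' neq tR'; have ribR' := tiling_ribbon tilQ QR'.
have b1 := tail_at_bound tR' R'b; have b2 := tail_at_bound tR Rij.
have [lt|ge] := ltrP (content (i.+1, j)) (m' + n%:Z - 1)%R; last first.
  apply: (horizontal_head QR' R'b _ (tiling_sub tilQ QR Rij)) => //.
  by move=> c /(tail_at_bound tR'); lia.
have [b Rb bE] : exists2 b, b \in R' & content b = (content (i.+1, j) + 1)%R by apply/tR'; lia.
case: (ribbon_next ribR' R'b Rb bE) => [E|[_ E]].
  by have := @horizontal_no_cross R' i j 1 QR' neq Rij; rewrite !addn1 -E => /(_ Rb).
by apply: neq; apply: (tiling_eq tilQ QR' QR Rb); rewrite E.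
Qed.

End Horizontal.

Lemma horizontal_del S Q R : horizontal_strip n S Q -> R \in Q -> skew_shape (S `\` R) ->
  horizontal_strip n (S `\` R) (Q `\ R).
Proof.
move=> [_ tilQ head] QR sk; split=> //; first exact: tiling_del.
move=> R'; rewrite !inE => /andP[_ QR'] i j /(head _ QR'); apply: contra.
by rewrite inE => /andP[].
Qed.

(** The box above the head of [R] has content beyond every ribbon of smaller tail, so it is not in
    [S]. The box above an older head is not in [R], because nothing of [S] lies below a box of
    [R]. *)
Lemma horizontal_add S Q R m : horizontal_strip n S Q -> ribbon n R -> [disjoint R & S]%fset ->
  skew_shape (S `|` R) -> tail_at R m ->
  (forall R' m', R' \in Q -> tail_at R' m' -> (m' < m)%R) ->
  (forall i j, (i, j) \in R -> (i.+1, j) \notin S /\ (i, j.+1) \notin S) ->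
  horizontal_strip n (S `|` R) (R |` Q).
Proof.
move=> [_ tilQ head] ribR dis sk tR lastR outR; split=> //; first exact: tiling_add.
move=> R'; rewrite !inE => /orP[/eqP-> i j top|QR' i j top]; last first.
  rewrite !inE negb_or (head _ QR' _ _ top) /=; apply/negP => /outR [/negP + _]; apply.
  by case: top => R'b _; apply: (tiling_sub tilQ QR' R'b).
have maxc := topright_content top; have [b Rb bE] := tail_at_max tR.
have H c : c \in R -> (content c < content (i, j))%R.
  move=> Rc; have := maxc c Rc; rewrite /content /=; lia.
rewrite !inE negb_or; apply/andP; split; last by apply/negP => /H; rewrite ltxx.
apply/negP => /(tiling_mem tilQ) [R1 Q1 R1b].
have [m1 t1] := ribbon_tail_at n_gt0 (tiling_ribbon tilQ Q1).
have := lastR _ _ Q1 t1; have := tail_at_bound t1 R1b; have := H b Rb; lia.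
Qed.

End Strips.

(** * Reflection in the main diagonal and strips of both kinds *)

Section Reflections.
Implicit Types (S R : boxes) (Q : {fset boxes}) (m : int) (b c : box) (i j k : nat).

Definition flip b : box := (b.2, b.1).

Lemma flipK : involutive flip. Proof. by case. Qed.

Lemma content_flip b : (content (flip b) = - content b)%R.
Proof. by case: b => i j; rewrite /content /=; lia. Qed.

Lemma mem_flip S b : (flip b \in reflect_boxes S) = (b \in S).
Proof.
apply/imfsetP/idP => /= [[c Sc bE]|Sb]; last by exists b.
by have -> : b = c by rewrite -[b]flipK bE -/(flip c) flipK.
Qed.

Lemma mem_reflect S i j : ((i, j) \in reflect_boxes S) = ((j, i) \in S).
Proof. exact: (mem_flip S (j, i)). Qed.

Lemma reflectK : involutive reflect_boxes.
Proof. by move=> S; apply/fsetP => -[i j]; rewrite !mem_reflect. Qed.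

Lemma reflectD S R : reflect_boxes (S `\` R) = reflect_boxes S `\` reflect_boxes R.
Proof. by apply/fsetP => -[i j]; rewrite !inE !mem_reflect !inE. Qed.

Lemma reflectU S R : reflect_boxes (S `|` R) = reflect_boxes S `|` reflect_boxes R.
Proof. by apply/fsetP => -[i j]; rewrite !inE !mem_reflect !inE. Qed.

Lemma reflect_ideal S : ideal S -> ideal (reflect_boxes S).
Proof. by move=> idS i j; rewrite !mem_reflect; case: (idS j i). Qed.

Lemma skew_reflect S : skew_shape S -> skew_shape (reflect_boxes S).
Proof.
move=> [lam [mu [sub SE]]].
have [lam' lamE] := ideal_young (reflect_ideal (@young_ideal lam)).
have [mu' muE] := ideal_young (reflect_ideal (@young_ideal mu)).
exists lam', mu'; rewrite lamE muE SE reflectD; split=> //.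
by apply/fsubsetP => -[i j]; rewrite !mem_reflect; apply: (fsubsetP sub).
Qed.

Lemma adjacent_flip b c : adjacent (flip b) (flip c) = adjacent b c.
Proof. by case: b c => [i j] [k l]; rewrite /adjacent /flip /= !xpair_eqE; lia. Qed.

Lemma card_reflect S : #|` reflect_boxes S| = #|` S|.
Proof. by rewrite card_imfset //; apply: (can_inj flipK). Qed.

Lemma ribbon_reflect n R : ribbon n R -> ribbon n (reflect_boxes R).
Proof.
move=> [sk conn cardR nsq]; split.
- exact: skew_reflect.
- move=> b c; rewrite -[b]flipK -[c]flipK !mem_flip => Rb Rc.
  have [p [pp sub] lp] := conn _ _ Rb Rc; exists (map flip p); last by rewrite last_map lp.
  split; last by move=> x /mapP[y /sub Ry ->]; rewrite mem_flip.
  rewrite path_map; apply: sub_path pp => x y; by rewrite /= adjacent_flip.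
- by rewrite card_reflect.
- move=> [i [j /fsubsetP sub]]; apply: nsq; exists j, i; apply/fsubsetP => -[k l].
  move=> H; rewrite -mem_reflect; apply: sub; move: H.
  by rewrite !inE !xpair_eqE; lia.
Qed.

(** Contents change sign, so the new least content is minus the old greatest one, [m + n - 1]. *)
Lemma tail_at_reflect n R m : tail_at n R m -> tail_at n (reflect_boxes R) (1 - m - n%:Z)%R.
Proof.
move=> tR k; have := tR (- k)%R => -[H1 H2]; split=> [[b Rb bE]|kE].
  have {H1} := H1 _; move=> H; suff : (m <= - k < m + n%:Z)%R by lia.
  by apply: H; exists (flip b); [rewrite -mem_flip flipK|rewrite content_flip bE].
have [|b Rb bE] := H2 _; first by lia.
by exists (flip b); rewrite ?mem_flip // content_flip; lia.
Qed.

Definition reflect_tiles Q := [fset reflect_boxes R | R in Q].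

Lemma mem_reflect_tiles Q R : (reflect_boxes R \in reflect_tiles Q) = (R \in Q).
Proof.
apply/imfsetP/idP => /= [[R' QR' /(inv_inj reflectK)->//]|QR]; by exists R.
Qed.

Section Strip.
Variable n : nat.
Hypothesis n_gt0 : 0 < n.
Notation tail_at := (tail_at n).
Notation ribbon := (ribbon n).

Definition strip (v : bool) S Q :=
  if v then vertical_strip n S Q else horizontal_strip n S Q.

(** Reflection negates contents, hence the reversed order for vertical strips. *)
Definition before (v : bool) (m' m : int) := if v then (m < m')%R else (m' < m)%R.

Lemma strip_uniq v S Q R R' m : strip v S Q -> R \in Q -> R' \in Q ->
  tail_at R m -> tail_at R' m -> R = R'.
Proof.
case: v => /= [vert QR QR' tR tR'|hor QR QR' tR tR'];
  last exact: (horizontal_uniq n_gt0 hor QR QR' tR tR').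
apply: (inv_inj reflectK).
by apply: (horizontal_uniq n_gt0 vert _ _ (tail_at_reflect tR) (tail_at_reflect tR'));
  rewrite -/(reflect_tiles Q) mem_reflect_tiles.
Qed.

Lemma strip_rim v S Q R m i j : strip v S Q -> R \in Q -> tail_at R m ->
  (forall R' m', R' \in Q -> R' <> R -> tail_at R' m' -> before v m' m) ->
  (i, j) \in R ->
  ((i, j.+1) \in S -> (i, j.+1) \in R) /\ ((i.+1, j) \in S -> (i.+1, j) \in R).
Proof.
case: v => /= [vert QR tR lastR Rij|hor QR tR lastR];
  last exact: (horizontal_rim n_gt0 hor QR tR lastR).
have := @horizontal_rim n n_gt0 _ _ vert (reflect_boxes R) _ _ (tail_at_reflect tR) _ j i.
rewrite -/(reflect_tiles Q) mem_reflect_tiles !mem_reflect => H.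
suff [] : ((i.+1, j) \in S -> (i.+1, j) \in R) /\ ((i, j.+1) \in S -> (i, j.+1) \in R) by [].
apply: H => // R' m'; rewrite -[R']reflectK; move: (reflect_boxes R') => {}R'.
rewrite mem_reflect_tiles => QR' neq /tail_at_reflect; rewrite reflectK => tR'.
suff: (m < 1 - m' - n%:Z)%R by lia.
by apply: lastR tR' => // E; apply: neq; rewrite E.
Qed.

Lemma strip_del v S Q R : strip v S Q -> R \in Q -> skew_shape (S `\` R) ->
  strip v (S `\` R) (Q `\ R).
Proof.
case: v => /= [vert QR sk|]; last exact: horizontal_del.
rewrite /vertical_strip; have -> : [fset reflect_boxes R | R in Q `\ R] =
    reflect_tiles Q `\ reflect_boxes R.
  apply/fsetP => R'; rewrite -[R']reflectK mem_reflect_tiles !inE mem_reflect_tiles.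
  by rewrite (inj_eq (inv_inj reflectK)).
rewrite reflectD; apply: horizontal_del => //; first by rewrite mem_reflect_tiles.
by rewrite -reflectD; apply: skew_reflect.
Qed.

Lemma strip_add v S Q R m : strip v S Q -> ribbon R -> [disjoint R & S]%fset ->
  skew_shape (S `|` R) -> tail_at R m ->
  (forall R' m', R' \in Q -> tail_at R' m' -> before v m' m) ->
  (forall i j, (i, j) \in R -> (i.+1, j) \notin S /\ (i, j.+1) \notin S) ->
  strip v (S `|` R) (R |` Q).
Proof.
case: v => /= [vert ribR /fdisjointP dis sk tR lastR outR|]; last exact: horizontal_add.
rewrite /vertical_strip; have -> : [fset reflect_boxes R | R in R |` Q] =
    reflect_boxes R |` reflect_tiles Q.
  apply/fsetP => R'; rewrite -[R']reflectK mem_reflect_tiles !inE mem_reflect_tiles.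
  by rewrite (inj_eq (inv_inj reflectK)).
rewrite reflectU; apply: (horizontal_add n_gt0 vert _ _ _ (tail_at_reflect tR)).
- exact: ribbon_reflect.
- by apply/fdisjointP => -[i j]; rewrite !mem_reflect => /dis.
- by rewrite -reflectU; apply: skew_reflect.
- move=> R' m'; rewrite -[R']reflectK; move: (reflect_boxes R') => {}R'.
  rewrite mem_reflect_tiles => QR' /tail_at_reflect; rewrite reflectK => tR'.
  by have := lastR _ _ QR' tR'; lia.
- by move=> i j; rewrite !mem_reflect => /outR [].
Qed.

Lemma skew0 : skew_shape fset0.
Proof.
have [lam lamE] : exists lam, young lam = fset0 by apply: ideal_young => i j; rewrite !inE.
by exists lam, lam; rewrite fsetDv; split.
Qed.

Lemma strip0 v : strip v fset0 fset0.
Proof.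
have H0 : horizontal_strip n fset0 fset0.
  split; [exact: skew0| |by move=> R]; split; do ?by move=> R.
  by apply/fsetP => b; rewrite inE; apply/negbTE/negP => /coverP[].
case: v => //=; rewrite /vertical_strip.
have -> : reflect_boxes fset0 = fset0 by apply/fsetP => -[i j]; rewrite mem_reflect !inE.
by have -> : [fset reflect_boxes R | R in fset0] = fset0
  by apply/fsetP => R; rewrite -[R]reflectK -/(reflect_tiles _) mem_reflect_tiles !inE.
Qed.

End Strip.

End Reflections.

(** * Adding and deleting the last ribbon of a tableau *)

Section Tableaux.
Variables (n p s : nat) (le : rel ('I_p + 'I_s)).
Hypothesis n_gt0 : 0 < n.
Hypothesis le_order : label_order le.
Notation label := ('I_p + 'I_s)%type.
Implicit Types (T : labelled_ribbons p s) (R S : boxes) (l : label) (m : int) (P : pred label)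
  (lam mu nu : intpart) (i j : nat).

Let le_anti : antisymmetric le. Proof. by case: le_order. Qed.
Let le_trans : transitive le. Proof. by case: le_order. Qed.
Let le_total : total le. Proof. by case: le_order. Qed.
Lemma label_refl l : le l l. Proof. by have := le_total l l; rewrite orbb. Qed.

Definition vertical_label l := if l is inr _ then true else false.

(* Within one label, the ribbons of a horizontal strip are added from left to
   right and those of a vertical strip from right to left. *)
Definition ribbon_lt (e' e : label * int) :=
  (le e'.1 e.1 && (e'.1 != e.1)) \/ (e'.1 = e.1 /\ before (vertical_label e.1) e'.2 e.2).

Lemma ribbons_inP T P R :
  reflect (exists2 l, (R, l) \in T & P l) (R \in ribbons_in T P).
Proof.
apply: (iffP (imfsetP _ _ _ _)) => /= [[[R' l]]|[l Tl Pl]].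
  by rewrite !inE /= => /andP[Tl Pl] ->; exists l.
by exists (R, l); rewrite // !inE Tl.
Qed.

Definition upto T mu P := young mu `|` cover (ribbons_in T P).

Lemma uptoP T mu P b :
  reflect (b \in young mu \/ exists R l, [/\ (R, l) \in T, P l & b \in R]) (b \in upto T mu P).
Proof.
apply: (iffP (fsetUP _ _ _)) => -[bmu|]; try by left.
- by move=> /coverP[R /ribbons_inP[l Tl Pl] Rb]; right; exists R, l.
- by move=> [R [l [Tl Pl Rb]]]; right; apply/coverP; exists R => //; apply/ribbons_inP; exists l.
Qed.

Section Facts.
Variables (lam mu : intpart) (T : labelled_ribbons p s).
Hypothesis tabT : super_tableau n le lam mu T.

Lemma tab_ribbon R l : (R, l) \in T -> ribbon n R.
Proof.
move=> Tl; case: (st_tiling tabT) => + _ _; apply; apply/ribbons_inP; by exists l.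
Qed.

Lemma tab_disjoint_mu R l b : (R, l) \in T -> b \in R -> b \notin young mu.
Proof.
move=> Tl Rb; have RQ : R \in ribbons_in T predT by apply/ribbons_inP; exists l.
by have := tiling_sub (st_tiling tabT) RQ Rb; rewrite inE => /andP[].
Qed.

Lemma tab_sub R l b : (R, l) \in T -> b \in R -> b \in young lam.
Proof.
move=> Tl Rb; have RQ : R \in ribbons_in T predT by apply/ribbons_inP; exists l.
by have := tiling_sub (st_tiling tabT) RQ Rb; rewrite inE => /andP[].
Qed.

Lemma tab_eq R l R' l' b : (R, l) \in T -> (R', l') \in T -> b \in R -> b \in R' ->
  (R, l) = (R', l').
Proof.
move=> Tl Tl' Rb Rb'.
have RQ : R \in ribbons_in T predT by apply/ribbons_inP; exists l.
have RQ' : R' \in ribbons_in T predT by apply/ribbons_inP; exists l'.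
have RE := tiling_eq (st_tiling tabT) RQ RQ' Rb Rb'.
by rewrite RE; congr pair; apply: (st_label tabT Tl Tl').
Qed.

Lemma tab_mem b : b \in young lam -> b \notin young mu ->
  exists R l, (R, l) \in T /\ b \in R.
Proof.
move=> blam bmu; have bS : b \in young lam `\` young mu by rewrite inE bmu.
have [R /ribbons_inP [l Tl _] Rb] := tiling_mem (st_tiling tabT) bS.
by exists R, l.
Qed.

Lemma tab_strip l : strip n (vertical_label l) (cover (ribbons_in T (pred1 l)))
  (ribbons_in T (pred1 l)).
Proof. by case: l => a; [apply: st_horizontal tabT a|apply: st_vertical tabT a]. Qed.

Lemma tab_uniq R R' l m : (R, l) \in T -> (R', l) \in T ->
  tail_at n R m -> tail_at n R' m -> R = R'.
Proof.
move=> Tl Tl'; apply: (strip_uniq n_gt0 (tab_strip l));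
  by apply/ribbons_inP; exists l => /=.
Qed.

(** A tableau provides diagrams only for the labels up to and including a given one. The strict
    version is the union of [mu] and the diagrams of all smaller labels, hence again closed upwards
    and leftwards. *)
Lemma upto_lt l : exists nu, young nu = upto T mu (fun l' => le l' l && (l' != l)).
Proof.
apply: ideal_young => i j.
suff H b b' : (forall nu, b \in young nu -> b' \in young nu) ->
    b \in upto T mu (fun l' => le l' l && (l' != l)) ->
    b' \in upto T mu (fun l' => le l' l && (l' != l)).
  by split; apply: H => nu; [exact: (@young_ideal nu i j).1|exact: (@young_ideal nu i j).2].
move=> nuP /uptoP[/nuP bmu|[R [l' [Tl /andP[lel nel] Rb]]]]; first by apply/uptoP; left.
have [nu nuE] := st_young tabT l'.
have : b \in young nu by rewrite nuE; apply/uptoP; right; exists R, l'; rewrite label_refl.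
move=> /nuP; rewrite nuE => /uptoP[bmu|[R' [l2 [Tl2 le2 Rb']]]]; apply/uptoP; first by left.
right; exists R', l2; split=> //; rewrite (le_trans le2 lel) /=.
by apply: contraNneq nel => l2E; apply/eqP/le_anti; rewrite lel -l2E.
Qed.

End Facts.

Lemma super_tableauI lam mu T :
  young mu `<=` young lam ->
  tiling n (young lam `\` young mu) (ribbons_in T predT) ->
  {in T &, forall t t', t.1 = t'.1 -> t.2 = t'.2} ->
  (forall l, exists nu : intpart, young nu = upto T mu (fun l' => le l' l)) ->
  (forall l, strip n (vertical_label l) (cover (ribbons_in T (pred1 l)))
    (ribbons_in T (pred1 l))) ->
  super_tableau n le lam mu T.
Proof.
move=> sub til lab yng str; split=> // [a|b]; first exact: (str (inl a)).
exact: (str (inr b)).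
Qed.

(** Removing [R] leaves a diagram because a box of [lam] right of or below [R] lies in [R]. It
    cannot have a label above [l], as [R] is last; nor a smaller label or lie in [mu], as these
    boxes form a diagram [U] disjoint from [R]; and within label [l] the strip has [R] on its
    rim. *)
Lemma tab_del lam mu T R l m : super_tableau n le lam mu T -> (R, l) \in T -> tail_at n R m ->
  (forall R' l' m', (R', l') \in T -> (R', l') <> (R, l) -> tail_at n R' m' ->
     ribbon_lt (l', m') (l, m)) ->
  exists nu, young nu = young lam `\` R /\ super_tableau n le nu mu (T `\ (R, l)).
Proof.
move=> tabT Tl tR lastR.
have le_l R' l' : (R', l') \in T -> le l' l.
  move=> Tl'; have [[_ ->]|/eqP neq] := eqVneq (R', l') (R, l); first exact: label_refl.
  have [m' tR'] := ribbon_tail_at n_gt0 (tab_ribbon tabT Tl').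
  by case: (lastR _ _ _ Tl' neq tR') => [/andP[]//|[/= -> _]]; apply: label_refl.
have [U UE] := upto_lt tabT l.
have Rn b : b \in R -> b \notin young U.
  move=> Rb; rewrite UE; apply/uptoP => -[bmu|[R' [l' [Tl' /andP[_ nel] Rb']]]].
    by have := tab_disjoint_mu tabT Tl Rb; rewrite bmu.
  by have [_ E] := tab_eq tabT Tl Tl' Rb Rb'; rewrite E eqxx in nel.
have lastP i j := @strip_rim n n_gt0 _ _ _ R m i j (tab_strip tabT l).
have QR : R \in ribbons_in T (pred1 l) by apply/ribbons_inP; exists l => /=.
have {}lastP i j := lastP i j QR tR.
have {}lastP i j : (i, j) \in R ->
   ((i, j.+1) \in cover (ribbons_in T (pred1 l)) -> (i, j.+1) \in R) /\
   ((i.+1, j) \in cover (ribbons_in T (pred1 l)) -> (i.+1, j) \in R).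
  apply: lastP => R' m' /ribbons_inP[l' Tl' /= /eqP l'E] neq tR'; subst l'.
  have neq' : (R', l) <> (R, l) by case.
  by case: (lastR _ _ _ Tl' neq' tR') => [|[_ //]]; rewrite /= eqxx andbF.
have idnu : ideal (young lam `\` R).
  move=> i j; suff H b : b \in young lam `\` R -> (i, j) \in young lam ->
     (forall nu, b \in young nu -> (i, j) \in young nu) ->
     ((i, j) \in R -> b \in cover (ribbons_in T (pred1 l)) -> b \in R) ->
     (i, j) \in young lam `\` R.
    have [l1 l2] := @young_ideal lam i j.
    split=> bS; have := bS; rewrite inE => /andP[_ blam]; apply: (H _ bS).
    - exact: l1.
    - by move=> nu; exact: (@young_ideal nu i j).1.
    - by move=> Rij; exact: (lastP _ _ Rij).2.
    - exact: l2.
    - by move=> nu; exact: (@young_ideal nu i j).2.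
    - by move=> Rij; exact: (lastP _ _ Rij).1.
  rewrite inE => /andP[nRb blam] ijlam dn inR; rewrite inE ijlam andbT.
  apply/negP => Rij; have bmu : b \notin young mu.
    by apply: contraTN (Rij) => /dn ijmu; apply/negP => /(tab_disjoint_mu tabT Tl); rewrite ijmu.
  have [R' [l' [Tl' Rb']]] := tab_mem tabT blam bmu.
  have [l'E|nel] := eqVneq l' l.
    move/negP: nRb; apply; apply: inR => //; apply/coverP; exists R' => //.
    by apply/ribbons_inP; exists l'; rewrite //= l'E.
  have : b \in young U.
    rewrite UE; apply/uptoP; right; exists R', l'; split=> //.
    by rewrite (le_l _ _ Tl') nel.
  by move=> /dn; apply/negP/Rn.
have [nu nuE] := ideal_young idnu; exists nu; split=> //.
have RT' R' l' : (R', l') \in T `\ (R, l) <-> (R', l') \in T /\ R' <> R.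
  rewrite !inE; split=> [/andP[neq Tl']|[Tl' neq]]; last first.
    by rewrite Tl' andbT; apply/eqP => -[].
  split=> // RE; subst R'; move/eqP: neq; apply; congr pair.
  exact: (st_label tabT Tl' Tl erefl).
have ribE P : P l -> ribbons_in (T `\ (R, l)) P = ribbons_in T P `\ R.
  move=> Pl; apply/fsetP => R'; rewrite !inE; apply/ribbons_inP/andP.
    by move=> [l' /RT'[Tl' neq] Pl']; split; [apply/eqP|apply/ribbons_inP; exists l'].
  by move=> [/eqP neq /ribbons_inP [l' Tl' Pl']]; exists l' => //; apply/RT'.
have ribN P : ~~ P l -> ribbons_in (T `\ (R, l)) P = ribbons_in T P.
  move=> Pl; apply/fsetP => R'; apply/ribbons_inP/ribbons_inP.
    by move=> [l' /RT'[Tl' neq] Pl']; exists l'.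
  move=> [l' Tl' Pl']; exists l' => //; apply/RT'; split=> // RE; subst R'.
  by have /= lE := st_label tabT Tl' Tl erefl; move: Pl; rewrite -lE Pl'.
have nuP b : b \in young nu -> b \notin young mu ->
    exists R' l', [/\ (R', l') \in T `\ (R, l), le l' l & b \in R'].
  rewrite nuE inE => /andP[nRb blam] bmu; have [R' [l' [Tl' Rb']]] := tab_mem tabT blam bmu.
  exists R', l'; split=> //; last exact: le_l Tl'.
  by apply/RT'; split=> // RE; rewrite -RE Rb' in nRb.
have RT'nu R' l' b : (R', l') \in T `\ (R, l) -> b \in R' -> b \in young nu.
  move=> /RT'[Tl' neq] Rb'; rewrite nuE inE (tab_sub tabT Tl' Rb') andbT.
  by apply: contra_notN neq => Rb; have [] := tab_eq tabT Tl' Tl Rb' Rb.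
apply: super_tableauI.
- apply/fsubsetP => b bmu; rewrite nuE inE (fsubsetP (st_sub tabT)) // andbT.
  by apply: contraTN bmu => /(tab_disjoint_mu tabT Tl).
- rewrite ribE //; have -> : young nu `\` young mu = (young lam `\` young mu) `\` R.
    by rewrite nuE; apply/fsetP => b; rewrite !inE andbCA.
  by apply: tiling_del; [exact: st_tiling tabT|apply/ribbons_inP; exists l].
- by move=> [R1 l1] [R2 l2] /RT'[T1 _] /RT'[T2 _]; apply: (st_label tabT T1 T2).
- move=> l0; have [lel|nle] := boolP (le l l0); last first.
    by have [nu' nu'E] := st_young tabT l0; exists nu'; rewrite nu'E /upto ribN.
  exists nu; apply/fsetP => b; apply/idP/uptoP => [bnu|[bmu|]].
  + have [bmu|bmu] := boolP (b \in young mu); [by left|right].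
    have [R' [l' [Tl' lel' Rb']]] := nuP b bnu bmu.
    by exists R', l'; split=> //; apply: le_trans lel' lel.
  + rewrite nuE inE (fsubsetP (st_sub tabT)) // andbT.
    by apply: contraTN bmu => /(tab_disjoint_mu tabT Tl).
  + by move=> [R' [l' [Tl' _ Rb']]]; exact: RT'nu Tl' Rb'.
- move=> l0; have [l0E|nel] := eqVneq l0 l; last first.
    by rewrite ribN //=; [exact: tab_strip tabT l0|rewrite eq_sym].
  subst l0; rewrite ribE //=.
  have covE : cover (ribbons_in T (pred1 l) `\ R) = cover (ribbons_in T (pred1 l)) `\` R.
    apply/fsetP => b; rewrite inE; apply/coverP/andP.
      move=> [R']; rewrite !inE => /andP[neq /ribbons_inP[l' Tl' l'E]] Rb'; split.
        by apply: contraNN neq => Rb; have [->] := tab_eq tabT Tl' Tl Rb' Rb.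
      by apply/coverP; exists R' => //; apply/ribbons_inP; exists l'.
    move=> [nRb /coverP [R' QR' Rb']]; exists R' => //; rewrite !inE QR' andbT.
    by apply: contraNneq nRb => <-.
  rewrite covE; apply: (strip_del (tab_strip tabT l) QR).
  (* What is left of the strip of [l] must again be a skew shape: it is the difference of [nu] and
     the diagram [U] of [mu] and the smaller labels. *)
  have subU : young U `<=` young nu.
    apply/fsubsetP => b; rewrite UE => /uptoP[bmu|[R' [l' [Tl' /andP[_ nel] Rb']]]].
      rewrite nuE inE (fsubsetP (st_sub tabT)) // andbT.
      by apply: contraTN bmu => /(tab_disjoint_mu tabT Tl).
    have Tl2 : (R', l') \in T `\ (R, l).
      apply/RT'; split=> // RE; subst R'.
      by have /= lE := st_label tabT Tl' Tl erefl; rewrite lE eqxx in nel.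
    exact: RT'nu Tl2 Rb'.
  exists nu, U; split=> //; apply/fsetP => b; rewrite !in_fsetD; apply/andP/andP.
    move=> [nRb /coverP[R' /ribbons_inP[l' Tl' /= /eqP l'E] Rb']]; subst l'.
    have Tl2 : (R', l) \in T `\ (R, l) by apply/RT'; split=> // RE; rewrite -RE Rb' in nRb.
    split; last exact: RT'nu Tl2 Rb'.
    rewrite UE; apply/uptoP => -[bmu|[R2 [l2 [T2 /andP[_ nel] Rb2]]]].
      by have := tab_disjoint_mu tabT Tl' Rb'; rewrite bmu.
    by have [_ E] := tab_eq tabT Tl' T2 Rb' Rb2; rewrite E eqxx in nel.
  move=> [nU bnu]; have bmu : b \notin young mu.
    by apply: contra nU => bmu; rewrite UE; apply/uptoP; left.
  have [R' [l' [Tl' lel' Rb']]] := nuP b bnu bmu; have /RT'[Tl2 neq] := Tl'.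
  split; first by apply: contra_notN neq => Rb; have [] := tab_eq tabT Tl2 Tl Rb' Rb.
  apply/coverP; exists R' => //; apply/ribbons_inP; exists l' => //=.
  apply: contraNT nU => nel; rewrite UE; apply/uptoP; right; exists R', l'.
  by rewrite lel' nel.
Qed.

(** A box of [nu] right of or below [R] would drag a box of [R] into [nu], so [R] can extend the
    strip of [l]. No label of [T] exceeds [l], so the diagram of any label from [l] on is all of
    [lam]. *)
Lemma tab_add lam mu nu T R l m : super_tableau n le nu mu T -> ribbon n R -> tail_at n R m ->
  [disjoint R & young nu]%fset -> young lam = young nu `|` R ->
  (forall R' l' m', (R', l') \in T -> tail_at n R' m' -> ribbon_lt (l', m') (l, m)) ->
  super_tableau n le lam mu ((R, l) |` T).
Proof.
move=> tabT ribR tR /fdisjointP dis lamE lastR.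
have le_l R' l' : (R', l') \in T -> le l' l.
  move=> Tl'; have [m' tR'] := ribbon_tail_at n_gt0 (tab_ribbon tabT Tl').
  by case: (lastR _ _ _ Tl' tR') => [/andP[]//|[/= -> _]]; apply: label_refl.
have RT' R' l' : (R', l') \in (R, l) |` T -> (R' = R /\ l' = l) \/ (R', l') \in T.
  by rewrite !inE => /orP[/eqP[-> ->]|]; [left|right].
have TR : (R, l) \in (R, l) |` T by rewrite !inE eqxx.
have TT R' l' : (R', l') \in T -> (R', l') \in (R, l) |` T by move=> Tl'; rewrite !inE Tl' orbT.
have subnu R' l' b : (R', l') \in T -> b \in R' -> b \in young nu.
  by move=> Tl' Rb'; exact: (tab_sub tabT Tl' Rb').
have TneR R' l' : (R', l') \in T -> R' <> R.
  move=> Tl' RE; subst R'; have [b Rb] := ribbon_neq0 n_gt0 ribR.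
  by have := dis b Rb; rewrite (subnu _ _ _ Tl' Rb).
have ribE P : P l -> ribbons_in ((R, l) |` T) P = R |` ribbons_in T P.
  move=> Pl; apply/fsetP => R'; rewrite !inE; apply/ribbons_inP/orP.
    move=> [l' /RT'[[-> _]|Tl'] Pl']; first by left.
    by right; apply/ribbons_inP; exists l'.
  by move=> [/eqP->|/ribbons_inP[l' Tl' Pl']]; [exists l|exists l' => //; apply: TT].
have ribN P : ~~ P l -> ribbons_in ((R, l) |` T) P = ribbons_in T P.
  move=> Pl; apply/fsetP => R'; apply/ribbons_inP/ribbons_inP.
    by move=> [l' /RT'[[_ ->]|Tl'] Pl']; [rewrite Pl' in Pl|exists l'].
  by move=> [l' Tl' Pl']; exists l' => //; apply: TT.
have mulam : young mu `<=` young lam.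
  by rewrite lamE; apply: fsubset_trans (st_sub tabT) _; apply: fsubsetUl.
have Rmu b : b \in R -> b \notin young mu.
  by move=> /dis; apply: contra; apply: (fsubsetP (st_sub tabT)).
apply: super_tableauI => //.
- rewrite ribE //; have -> : young lam `\` young mu = (young nu `\` young mu) `|` R.
    rewrite lamE; apply/fsetP => b; rewrite !in_fsetU !in_fsetD in_fsetU andb_orr; congr (_ || _).
    by have := Rmu b; case: (b \in R) => [->//|_]; rewrite andbF.
  apply: tiling_add => //; first exact: st_tiling tabT.
  by apply/fdisjointP => b /dis; rewrite inE negb_and orbC => ->.
- move=> [R1 l1] [R2 l2] /RT'[[-> ->]|T1] /RT'[[-> ->]|T2] //= RE.
  + by case: (TneR _ _ T2).
  + by case: (TneR _ _ T1).
  + exact: (st_label tabT T1 T2).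
- move=> l0; have [lel|nle] := boolP (le l l0); last first.
    by have [nu' nu'E] := st_young tabT l0; exists nu'; rewrite nu'E /upto ribN.
  exists lam; apply/fsetP => b; rewrite lamE; apply/fsetUP/uptoP => [[bnu|Rb]|[bmu|]].
  + have [bmu|bmu] := boolP (b \in young mu); [by left|right].
    have [R' [l' [Tl' Rb']]] := tab_mem tabT bnu bmu; exists R', l'.
    by rewrite TT //; split=> //; apply: le_trans (le_l _ _ Tl') lel.
  + by right; exists R, l.
  + by left; apply: (fsubsetP (st_sub tabT)).
  + by move=> [R' [l' [/RT'[[-> _]|Tl'] _ Rb']]]; [right|left; exact: subnu Tl' Rb'].
- move=> l0; have [l0E|nel] := eqVneq l0 l; last first.
    by rewrite ribN //=; [exact: tab_strip tabT l0|rewrite eq_sym].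
  subst l0; rewrite ribE //=.
  have covE : cover (R |` ribbons_in T (pred1 l)) = cover (ribbons_in T (pred1 l)) `|` R.
    apply/fsetP => b; rewrite inE; apply/coverP/orP.
      by move=> [R']; rewrite !inE => /orP[/eqP->|QR'] Rb'; [right|left; apply/coverP; exists R'].
    case=> [/coverP[R' QR' Rb']|Rb]; [exists R' => //|exists R => //]; rewrite !inE ?eqxx //.
    by rewrite QR' orbT.
  have covnu b : b \in cover (ribbons_in T (pred1 l)) -> b \in young nu.
    by move=> /coverP[R' /ribbons_inP[l' Tl' _]]; apply: subnu Tl'.
  have [U UE] := upto_lt tabT l.
  rewrite covE; apply: (strip_add n_gt0 (tab_strip tabT l) ribR _ _ tR).
  + by apply/fdisjointP => b /dis; apply: contra; apply: covnu.
  + have subU : young U `<=` young nu.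
      apply/fsubsetP => b; rewrite UE => /uptoP[|[R' [l' [Tl' _ Rb']]]].
        exact: (fsubsetP (st_sub tabT)).
      exact: subnu Tl' Rb'.
    exists lam, U; split; first by rewrite lamE; apply: fsubset_trans subU _; apply: fsubsetUl.
    apply/fsetP => b; rewrite lamE in_fsetD !in_fsetU; apply/orP/andP => [[bS|Rb]|[nU]].
    * rewrite covnu //; split=> //; rewrite UE; apply/uptoP.
      move: bS => /coverP[R' /ribbons_inP[l' Tl' /= /eqP l'E] Rb']; subst l'.
      case=> [bmu|[R2 [l2 [T2 /andP[_ nel] Rb2]]]].
        by have := tab_disjoint_mu tabT Tl' Rb'; rewrite bmu.
      by have [_ E] := tab_eq tabT Tl' T2 Rb' Rb2; rewrite E eqxx in nel.
    * by rewrite Rb orbT; split=> //; apply: contra (dis b Rb); apply: (fsubsetP subU).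
    * move=> /orP[bnu|]; [left|by right].
      have bmu : b \notin young mu.
        by apply: contra nU => bmu; rewrite UE; apply/uptoP; left.
      have [R' [l' [Tl' Rb']]] := tab_mem tabT bnu bmu.
      apply/coverP; exists R' => //; apply/ribbons_inP; exists l' => //=.
      apply: contraNT nU => nel; rewrite UE; apply/uptoP; right; exists R', l'.
      by rewrite (le_l _ _ Tl') nel.
  + move=> R' m' /ribbons_inP[l' Tl' /= /eqP l'E] tR'; subst l'.
    by case: (lastR _ _ _ Tl' tR') => [|[]//]; rewrite /= eqxx andbF.
  + move=> i j Rij; have := dis _ Rij; have [l1 l2] := @young_ideal nu i j.
    by move=> nij; split; apply: contra nij => /covnu; [exact: l1|exact: l2].
Qed.

Lemma tab_empty mu : super_tableau n le mu mu fset0.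
Proof.
have rib0 P : ribbons_in fset0 P = fset0 :> {fset boxes}.
  by apply/fsetP => R; rewrite inE; apply/negbTE/negP => /ribbons_inP[l]; rewrite inE.
have cov0 : cover fset0 = fset0.
  by apply/fsetP => b; rewrite inE; apply/negbTE/negP => /coverP[R]; rewrite inE.
apply: super_tableauI => //.
- by rewrite rib0 fsetDv; split=> [R|R R'|]; rewrite ?in_fset0.
- by move=> l; exists mu; rewrite /upto rib0 cov0 fsetU0.
- by move=> l; rewrite rib0 cov0; apply: strip0.
Qed.

End Tableaux.

(** * Ribbons as runs of boxes along the outer rim *)

Section Staircase.
Variables (h : nat -> nat) (A : nat).

(** The box of content [c - A] in row [h c]. When [h c] counts the beads of a partition at sites at
    least [c], it is the first box outside the diagram on that diagonal. *)
Definition stair (c : nat) : box := (h c, c + h c - A).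
Definition stairs c m : boxes := [fset stair k | k in iota c m].

Hypothesis hS : forall c, h c.+1 <= h c <= (h c.+1).+1.
Hypothesis hA : forall c, A <= c + h c.

Lemma content_stair c : (content (stair c) = c%:Z - A%:Z)%R.
Proof. by have := hA c; rewrite /content /=; lia. Qed.

Lemma stair_inj : injective stair.
Proof. by move=> c c' /(congr1 content); rewrite !content_stair; lia. Qed.

Lemma mem_stairs c m b :
  reflect (exists2 k, c <= k < c + m & b = stair k) (b \in stairs c m).
Proof.
by apply: (iffP (imfsetP _ _ _ _)) => /= -[k]; rewrite ?mem_iota => kE ->;
  exists k; rewrite ?mem_iota.
Qed.

Lemma card_stairs c m : #|` stairs c m| = m.
Proof.
rewrite card_imfset_seq ?size_iota ?iota_uniq // => k k' _ _; exact: stair_inj.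
Qed.

Lemma adjacent_stair c : adjacent (stair c) (stair c.+1).
Proof.
have := hS c; have := hA c; have := hA c.+1; rewrite /adjacent /stair /= !xpair_eqE.
by case: (eqVneq (h c) (h c.+1)) => [->|]; lia.
Qed.

Lemma adjacentC b c : adjacent b c = adjacent c b.
Proof. by rewrite /adjacent; do !case: (_ == _). Qed.

Lemma stairs_connected c m : connected (stairs c m).
Proof.
suff H k d : forall b, c <= k -> k + d < c + m -> b = stair k \/ b = stair (k + d) ->
    exists2 p : seq box, path adjacent b p /\ {subset p <= stairs c m} &
    last b p = if b == stair k then stair (k + d) else stair k.
  move=> b b' /mem_stairs[k kE ->] /mem_stairs[k' kE' ->].
  have [le|lt] := leqP k k'.
    have H1 : c <= k by lia.
    have H2 : k + (k' - k) < c + m by lia.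
    have [p pp] := H k (k' - k) _ H1 H2 (or_introl erefl).
    by rewrite eqxx subnKC // => lp; exists p.
  have H1 : c <= k' by lia.
  have H2 : k' + (k - k') < c + m by lia.
  have [p pp] := H k' (k - k') _ H1 H2 (or_intror erefl).
  rewrite subnKC ?(ltnW lt) // in pp *.
  by rewrite (inj_eq stair_inj) gtn_eqF // => lp; exists p.
elim: d => [|d IHd] b ck kd; first by rewrite addn0; case=> ->; exists [::]; rewrite ?eqxx.
have kd' : k + d < c + m by lia.
case=> ->.
  have [p [pp sp] lp] := IHd (stair k) ck kd' (or_introl erefl).
  rewrite eqxx in lp; exists (rcons p (stair (k + d.+1))); last by rewrite eqxx last_rcons.
  rewrite rcons_path pp lp addnS adjacent_stair; split=> // x; rewrite mem_rcons inE.
  by case/orP=> [/eqP->|/sp//]; apply/mem_stairs; exists (k + d).+1 => //; lia.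
have [p [pp sp] lp] := IHd (stair (k + d)) ck kd' (or_intror erefl).
exists (stair (k + d) :: p).
  rewrite /= addnS adjacentC adjacent_stair; split=> // x; rewrite inE.
  by case/orP=> [/eqP->|/sp//]; apply/mem_stairs; exists (k + d) => //; lia.
rewrite /= lp !(inj_eq stair_inj); case: (eqVneq (k + d) k) => [E|_].
  by rewrite E; case: eqP => //; lia.
by case: eqP => //; lia.
Qed.

Lemma stairs_no_square c m : ~ has_square (stairs c m).
Proof.
move=> [i [j /fsubsetP sub]].
have /mem_stairs[k _ kE] : (i, j) \in stairs c m by apply: sub; rewrite !inE eqxx.
have /mem_stairs[k' _ kE'] : (i.+1, j.+1) \in stairs c m by apply: sub; rewrite !inE eqxx !orbT.
have := congr1 content kE; have := congr1 content kE'; rewrite !content_stair /content /= => E1 E2.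
have E : k = k' by lia.
by move: kE kE'; rewrite E => <- []; lia.
Qed.

Lemma height_mono c c' : c <= c' -> h c' <= h c.
Proof.
move=> /subnK <-; elim: (c' - c) => // d IHd; rewrite addSn; apply: leq_trans IHd.
by have := hS (d + c); lia.
Qed.

(** Since [h] falls by at most one per step, the run meets every row between those of its two
    ends. *)
Lemma rows_stairs c m : #|` [fset b.1 | b in stairs c m.+1]| = (h c - h (c + m)).+1.
Proof.
have -> : [fset b.1 | b in stairs c m.+1] = [fset h k | k in iota c m.+1].
  apply/fsetP => i; apply/imfsetP/imfsetP => -[].
    by move=> b /mem_stairs [k kE ->] ->; exists k; rewrite ?mem_iota.
  move=> k; rewrite mem_iota => kE ->; exists (stair k) => //.
  by apply/mem_stairs; exists k.
elim: m c => [|m IHm] c.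
  rewrite addn0 subnn; have -> : [fset h k | k in iota c 1] = [fset h c].
    apply/fsetP => i; rewrite inE; apply/imfsetP/eqP => [[k]|->].
      by rewrite mem_iota => kE ->; congr h; lia.
    by exists c; rewrite ?mem_iota //; lia.
  by rewrite cardfs1.
have -> : [fset h k | k in iota c m.+2] = h c |` [fset h k | k in iota c.+1 m.+1].
  apply/fsetP => i; rewrite inE in_fset1; apply/imfsetP/orP => [[k]|].
    rewrite mem_iota => kE ->; have [->|nk] := eqVneq k c; [by left|right].
    by apply/imfsetP; exists k; rewrite ?mem_iota //; lia.
  case=> [/eqP->|/imfsetP[k]]; first by exists c; rewrite ?mem_iota //; lia.
  by rewrite mem_iota => kE ->; exists k; rewrite ?mem_iota //; lia.
rewrite cardfsU1 IHm; have := hS c; have : h (c.+1 + m) <= h c.+1 by apply: height_mono; lia.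
rewrite !addnS addSn; case: imfsetP => [[k]|nex].
  rewrite mem_iota => kE hE; have : h k <= h c.+1 by apply: height_mono; lia.
  lia.
have : h c <> h c.+1 by move=> E; apply: nex; exists c.+1; rewrite ?mem_iota //; lia.
by lia.
Qed.

End Staircase.

Local Open Scope ring_scope.


(** * Ribbon operators on bead configurations *)

Section States.
Variable L : nat.

(* The sites p < L; sites below the window are thought of as occupied, those
   above it as empty. *)
Definition state := {ffun 'I_L -> bool}.

Definition occ (s : state) (p : nat) : bool := oapp s false (insub p).

Lemma occ_ge s p : (L <= p)%N -> occ s p = false.
Proof. by move=> Lp; rewrite /occ insubN // -leqNgt. Qed.

Lemma occE s (i : 'I_L) : occ s i = s i.
Proof. by rewrite /occ valK. Qed.

Lemma occ_inj s s' : occ s =1 occ s' -> s = s'.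
Proof. by move=> eqs; apply/ffunP => i; rewrite -!occE. Qed.

Definition mkstate (f : nat -> bool) : state := [ffun i : 'I_L => f i].

Lemma occ_mkstate f p : (p < L)%N -> occ (mkstate f) p = f p.
Proof. by move=> ltp; rewrite /occ insubT /= ffunE. Qed.

Definition count (s : state) (P : pred nat) : nat :=
  (\sum_(p < L) (P p && occ s p))%N.

(** Stated additively, since subtraction on [nat] truncates. *)
Lemma sum_diff1 (F G : nat -> nat) a :
  (a < L)%N -> (forall p, p <> a -> F p = G p) ->
  (\sum_(p < L) F p + G a = \sum_(p < L) G p + F a)%N.
Proof.
move=> lta FG; rewrite (bigD1 (Ordinal lta)) //= [in RHS](bigD1 (Ordinal lta)) //=.
rewrite (eq_bigr (fun p : 'I_L => G p)) => [|p /eqP pa]; first by lia.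
by apply: FG => pE; apply: pa; apply: val_inj.
Qed.

Lemma sum_diff2 (F G : nat -> nat) a c :
  (a < L)%N -> (c < L)%N -> a <> c -> (forall p, p <> a -> p <> c -> F p = G p) ->
  (\sum_(p < L) F p + (G a + G c) = \sum_(p < L) G p + (F a + F c))%N.
Proof.
move=> lta ltc neq FG; pose H p := if p == a then G p else F p.
have FH : (\sum_(p < L) F p + H a = \sum_(p < L) H p + F a)%N.
  by apply: sum_diff1 => // p /eqP/negPf pa; rewrite /H pa.
have HG : (\sum_(p < L) H p + G c = \sum_(p < L) G p + H c)%N.
  apply: sum_diff1 => // p pc; rewrite /H; case: eqP => // pa; exact: FG.
have Ha : H a = G a by rewrite /H eqxx.
have Hc : H c = F c by rewrite /H; case: eqP => // ca; case: neq.
lia.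
Qed.

End States.

Section Moves.
Variables (n L : nat).
Hypothesis n_gt0 : (0 < n)%N.
Notation state := (state L).
Implicit Types (s : state) (b c p : nat).

Definition swp b p := if p == b then (b + n)%N else if p == (b + n)%N then b else p.
(** One involution serves both for adding and for removing a ribbon; the direction is decided by the
    occupancy tests in [up] and [dn]. *)
Definition move b s : state := mkstate L (fun p => occ s (swp b p)).

Lemma occ_move b s p : (b + n < L)%N -> occ (move b s) p = occ s (swp b p).
Proof.
move=> ltb; case: (ltnP p L) => [|geL]; first exact: occ_mkstate.
by rewrite !occ_ge // /swp; do ?case: eqP; lia.
Qed.

Lemma occ_move1 b s : (b + n < L)%N -> occ (move b s) b = occ s (b + n)%N.
Proof. by move=> ltb; rewrite occ_move // /swp eqxx. Qed.

Lemma occ_move2 b s : (b + n < L)%N -> occ (move b s) (b + n)%N = occ s b.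
Proof. by move=> ltb; rewrite occ_move // /swp eqxx; case: eqP => // ->. Qed.

Lemma occ_move_neq b s p : (b + n < L)%N -> p <> b -> p <> (b + n)%N ->
  occ (move b s) p = occ s p.
Proof. by move=> ltb /eqP/negPf pb /eqP/negPf pbn; rewrite occ_move // /swp pb pbn. Qed.

Lemma moveK b : (b + n < L)%N -> involutive (move b).
Proof.
move=> ltb s; apply: occ_inj => p; rewrite !occ_move // /swp.
by congr occ; do !case: eqP => //; lia.
Qed.

Lemma moveC b c s : (b + n < L)%N -> (c + n < L)%N ->
  b <> c -> c <> (b + n)%N -> b <> (c + n)%N ->
  move b (move c s) = move c (move b s).
Proof.
move=> ltb ltc bc cb cb'; apply: occ_inj => p; rewrite !occ_move // /swp.
by congr occ; do !case: eqP => //; lia.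
Qed.

Lemma count_move b s (P : pred nat) : (b + n < L)%N ->
  (count (move b s) P + ((P b && occ s b) + (P (b + n) && occ s (b + n))) =
   count s P + ((P b && occ s (b + n)) + (P (b + n) && occ s b)))%N.
Proof.
move=> ltb.
have := @sum_diff2 L (fun p => P p && occ (move b s) p : nat)
  (fun p => P p && occ s p : nat) b (b + n)%N.
rewrite occ_move1 // occ_move2 // => -> //; try lia.
by move=> p pb pbn; rewrite occ_move_neq.
Qed.

Definition btw s b := count s (fun p => b < p < b + n)%N.
Definition blk s b := count s (fun p => b <= p < b + n)%N.

Lemma blkE s b : (b + n < L)%N -> blk s b = (occ s b + btw s b)%N.
Proof.
move=> ltb.
have := @sum_diff1 L (fun p => (b <= p < b + n)%N && occ s p : nat)
  (fun p => (b < p < b + n)%N && occ s p : nat) b.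
rewrite -/(count s (fun p => b <= p < b + n)%N) -/(count s (fun p => b < p < b + n)%N).
rewrite -/(blk s b) -/(btw s b) leqnn ltnn.
rewrite -[X in (X < _ + n)%N]addn0 ltn_add2l n_gt0 /= addn0 addnC => ->; [lia|lia|].
by move=> p pb; congr (nat_of_bool (_ && _)); lia.
Qed.

Lemma blkSE s b : (b + n < L)%N -> blk s b.+1 = (btw s b + occ s (b + n))%N.
Proof.
move=> ltb.
have := @sum_diff1 L (fun p => (b < p < b.+1 + n)%N && occ s p : nat)
  (fun p => (b < p < b + n)%N && occ s p : nat) (b + n)%N ltb.
rewrite -/(count s (fun p => b < p < b.+1 + n)%N) -/(count s (fun p => b < p < b + n)%N).
rewrite -/(blk s b.+1) -/(btw s b) ltnn andbF /= addn0 => ->.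
  by congr (_ + _)%N; lia.
by move=> p pb; congr (nat_of_bool (_ && _)); lia.
Qed.

Lemma btw_move s b : (b + n < L)%N -> btw (move b s) b = btw s b.
Proof.
by move=> ltb; have := count_move s (fun p => b < p < b + n)%N ltb; rewrite !ltnn andbF /= !addn0.
Qed.

(** The total spin of the two moves is independent of their order, because each move changes the
    spin of the other by the same amount: [c + n] lies between [b] and [b + n] iff [b] lies between
    [c] and [c + n], and [c] lies between [b] and [b + n] iff [b + n] lies between [c] and
    [c + n]. *)
Lemma btw_moveC s b c : (b + n < L)%N -> (c + n < L)%N ->
  b <> c -> c <> (b + n)%N -> b <> (c + n)%N ->
  occ s c -> ~~ occ s (c + n) -> ~~ occ s b -> occ s (b + n) ->
  (btw s c + btw (move c s) b = btw s b + btw (move b s) c)%N.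
Proof.
move=> ltb ltc bc cb cb' sc /negPf sc' /negPf sb sb'.
have := count_move s (fun p => b < p < b + n)%N ltc.
have := count_move s (fun p => c < p < c + n)%N ltb.
rewrite -/(btw s b) -/(btw s c) -/(btw (move c s) b) -/(btw (move b s) c).
by rewrite sc sc' sb sb' !andbT !andbF; lia.
Qed.

Section Operators.
Variables (K : comNzRingType) (q : K).
Implicit Types (phi psi : state -> K) (x y : K) (f g : nat -> K).

(* The operators act on functions of the state: [up b phi s] reads [phi] at the
   state from which [s] is obtained by adding a ribbon. *)
Definition up b phi s :=
  if ~~ occ s b && occ s (b + n) then q ^+ btw s b * phi (move b s) else 0.
Definition dn b phi s :=
  if occ s b && ~~ occ s (b + n) then q ^+ btw s b * phi (move b s) else 0.
Definition up1 x b phi s := phi s + x * up b phi s.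
Definition dn1 y b phi s := phi s + y * dn b phi s.
Definition diag f b phi s := f (blk s b) * phi s.

(** If the two pairs of sites share a site, both composites vanish: one move leaves there the
    opposite of what the other requires. Otherwise the moves commute and the exponents agree by
    [btw_moveC]. *)
Lemma dn_up b c phi : (b + n < L)%N -> (c + n < L)%N -> b <> c ->
  dn c (up b phi) = up b (dn c phi).
Proof.
move=> ltb ltc bc; apply/funext => s; rewrite /dn /up.
have [cE|/eqP cb] := eqVneq c (b + n)%N.
  subst c; rewrite (occ_move1 _ ltc) (occ_move2 _ ltb).
  case: (occ s (b + n)); case: (occ s b); case: (occ s (b + n + n)) => //=;
  by rewrite ?andbF ?mulr0.
have [bE|/eqP cb'] := eqVneq b (c + n)%N.
  subst b; rewrite (occ_move1 _ ltb) (occ_move2 _ ltc).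
  case: (occ s (c + n)); case: (occ s c); case: (occ s (c + n + n)) => //=;
  by rewrite ?andbF ?mulr0.
rewrite !(@occ_move_neq c) ?(@occ_move_neq b) //; try lia.
case sc: (occ s c && ~~ occ s (c + n)); case sb: (~~ occ s b && occ s (b + n));
  rewrite ?mulr0 //.
move: sc sb => /andP[sc sc'] /andP[sb sb'].
by rewrite !mulrA -!exprD moveC // btw_moveC.
Qed.

Lemma up_lin x b phi psi :
  up b (fun s => phi s + x * psi s) = fun s => up b phi s + x * up b psi s.
Proof.
apply/funext => s; rewrite /up; case: ifP; rewrite ?mulr0 ?addr0 // => _; ring.
Qed.

Lemma dn_lin x b phi psi :
  dn b (fun s => phi s + x * psi s) = fun s => dn b phi s + x * dn b psi s.
Proof.
apply/funext => s; rewrite /dn; case: ifP; rewrite ?mulr0 ?addr0 // => _; ring.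
Qed.

Lemma dn1_up1 x y b c phi : (b + n < L)%N -> (c + n < L)%N -> b <> c ->
  dn1 y c (up1 x b phi) = up1 x b (dn1 y c phi).
Proof.
move=> ltb ltc bc; apply/funext => s.
rewrite /dn1 /up1 dn_lin up_lin dn_up //; ring.
Qed.

(** If both sites [b] and [b + n] are occupied, or neither, [up] and [dn] vanish and the two block
    counts agree. The other two states, with N = [btw s b] beads strictly between, give an identity
    of 2x2 matrices whose only nontrivial entries are the recurrence [fE] at N; there the blocks at
    [b] and [b.+1] take the values N and N + 1 in opposite ways. *)
Ltac local_relation b s fE :=
  rewrite /up1 /dn1 /diag /up /dn ?moveK ?blkSE ?(@blkE _ b)
    ?occ_move1 ?occ_move2 ?btw_move ?moveK //;
  have := fE (btw s b); rewrite mulnC exprM;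
  case: (occ s b); case: (occ s (b + n)%N) => //=;
  rewrite ?addn0 ?add0n ?addn1 ?add1n ?mulr0 ?addr0 //.

(* In the next four lemmas, [f (blk _)] is the scalar accumulated while a sweep
   passes through another one; it moves from one end of the window to the other. *)
Lemma dn1_diag_up1 f x y b phi : (b + n < L)%N ->
  (forall N, f N.+1 * (1 - x * y * q ^+ (2 * N)) = f N) ->
  dn1 y b (diag f b.+1 (up1 x b phi)) = up1 x b (diag f b (dn1 y b phi)).
Proof.
move=> ltb fE; apply/funext => s; local_relation b s fE.
- by move=> <-; ring.
- by move=> <-; ring.
Qed.

Lemma dn1_diag_up1_rev f x y b phi : (b + n < L)%N ->
  (forall N, f N * (1 - x * y * q ^+ (2 * N)) = f N.+1) ->
  dn1 y b (diag f b (up1 x b phi)) = up1 x b (diag f b.+1 (dn1 y b phi)).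
Proof.
move=> ltb fE; apply/funext => s; local_relation b s fE.
- by move=> <-; ring.
- by move=> <-; ring.
Qed.

Lemma diag_dn1_up1 f x y b phi : (b + n < L)%N ->
  (forall N, f N.+1 * (1 + x * y * q ^+ (2 * N)) = f N) ->
  diag f b (dn1 y b (up1 x b phi)) = up1 x b (dn1 y b (diag f b.+1 phi)).
Proof.
move=> ltb fE; apply/funext => s; local_relation b s fE.
- by move=> <-; ring.
- by move=> <-; ring.
Qed.

Lemma diag_dn1_up1_rev f x y b phi : (b + n < L)%N ->
  (forall N, f N * (1 + x * y * q ^+ (2 * N)) = f N.+1) ->
  diag f b.+1 (dn1 y b (up1 x b phi)) = up1 x b (dn1 y b (diag f b phi)).
Proof.
move=> ltb fE; apply/funext => s; local_relation b s fE.
- by move=> <-; ring.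
- by move=> <-; ring.
Qed.

End Operators.
End Moves.


(** * Exchange of full sweeps *)

Section Sweeps.
Variables (n L : nat).
Hypothesis n_gt0 : (0 < n)%N.
Variables (K : comNzRingType) (q : K).
Notation state := (state L).
Notation up1 := (@up1 n L K q).
Notation dn1 := (@dn1 n L K q).
Notation diag := (@diag n L K).
Implicit Types (phi psi : state -> K) (x y : K) (f g : nat -> K) (l : seq nat) (s : state).

(** [sweep_up] applies its operators in the order of the list and [sweep_dn] in the reverse order,
    which makes them transposes for the same list. *)
Definition sweep_up x l phi := foldl (fun phi b => up1 x b phi) phi l.
Definition sweep_dn y l phi := foldr (fun b phi => dn1 y b phi) phi l.

Lemma sweep_dn_cat y l l' phi :
  sweep_dn y (l ++ l') phi = sweep_dn y l (sweep_dn y l' phi).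
Proof. exact: foldr_cat. Qed.

Lemma sweep_up_cat x l l' phi :
  sweep_up x (l ++ l') phi = sweep_up x l' (sweep_up x l phi).
Proof. exact: foldl_cat. Qed.

Lemma sweep_dn_up1 x y b l phi : (b + n < L)%N ->
  {in l, forall c, (c + n < L)%N /\ b <> c} ->
  sweep_dn y l (up1 x b phi) = up1 x b (sweep_dn y l phi).
Proof.
move=> ltb; elim: l phi => //= c l IHl phi ltl.
have [ltc bc] := ltl c (mem_head _ _).
rewrite IHl ?dn1_up1 // => c' lc'.
by apply: ltl; rewrite in_cons lc' orbT.
Qed.

Lemma dn1_sweep_up x y c l phi : (c + n < L)%N ->
  {in l, forall b, (b + n < L)%N /\ b <> c} ->
  dn1 y c (sweep_up x l phi) = sweep_up x l (dn1 y c phi).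
Proof.
move=> ltc; elim: l phi => //= b l IHl phi ltl.
have [ltb bc] := ltl b (mem_head _ _).
rewrite IHl ?dn1_up1 // => c' lc'.
by apply: ltl; rewrite in_cons lc' orbT.
Qed.

(* [true]: decreasing order, for vertical strips. *)
Definition sites (v : bool) (M : nat) := if v then rev (iota 0 M) else iota 0 M.
Arguments sites : simpl never.

Lemma mem_sites v M b : (b \in sites v M) = (b < M)%N.
Proof. by case: v; rewrite /= ?mem_rev mem_iota. Qed.

Lemma sitesS v M : sites v M.+1 = if v then M :: sites v M else sites v M ++ [:: M].
Proof. by case: v; rewrite /sites -{1}addn1 iotaD // rev_cat. Qed.

Variables (x y : K).

Let side M : (M + n < L)%N -> forall v, {in sites v M, forall c, (c + n < L)%N /\ M <> c}.
Proof. by move=> ltM v c; rewrite mem_sites => ltc; split; lia. Qed.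
Let side' M : (M + n < L)%N -> forall v, {in sites v M, forall c, (c + n < L)%N /\ c <> M}.
Proof. by move=> ltM v c; rewrite mem_sites => ltc; split; lia. Qed.

(** In the four names the first letter is the kind of the sweep of [dn1], the second that of [up1]:
    [H] for increasing sites, [E] for decreasing ones. The operators at the new site [M] commute
    with the sweeps over smaller sites; where they meet, next to the scalar, the local relation
    exchanges them and shifts the scalar by one site. *)
Lemma sweep_HH f M phi : (M + n <= L)%N ->
  (forall N, f N.+1 * (1 - x * y * q ^+ (2 * N)) = f N) ->
  sweep_dn y (sites false M) (diag f M (sweep_up x (sites false M) phi)) =
  sweep_up x (sites false M) (diag f 0 (sweep_dn y (sites false M) phi)).
Proof.
move=> leM fE; elim: M leM phi => // M IHM leM phi; have ltM : (M + n < L)%N by lia.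
rewrite !sitesS !sweep_dn_cat !sweep_up_cat /=.
rewrite dn1_diag_up1 // sweep_dn_up1 //; last exact: side.
rewrite dn1_sweep_up // ?IHM ?(ltnW ltM) //; last exact: side'.
Qed.

Lemma sweep_EE f M phi : (M + n <= L)%N ->
  (forall N, f N * (1 - x * y * q ^+ (2 * N)) = f N.+1) ->
  sweep_dn y (sites true M) (diag f 0 (sweep_up x (sites true M) phi)) =
  sweep_up x (sites true M) (diag f M (sweep_dn y (sites true M) phi)).
Proof.
move=> leM fE; elim: M leM phi => // M IHM leM phi; have ltM : (M + n < L)%N by lia.
rewrite !sitesS /=.
rewrite IHM ?(ltnW ltM) // sweep_dn_up1 // ?dn1_sweep_up ?dn1_diag_up1_rev //.
- exact: side'.
- exact: side.
Qed.

Lemma sweep_HE f M phi : (M + n <= L)%N ->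
  (forall N, f N.+1 * (1 + x * y * q ^+ (2 * N)) = f N) ->
  diag f 0 (sweep_dn y (sites false M) (sweep_up x (sites true M) phi)) =
  sweep_up x (sites true M) (sweep_dn y (sites false M) (diag f M phi)).
Proof.
move=> leM fE; elim: M leM phi => // M IHM leM phi; have ltM : (M + n < L)%N by lia.
rewrite !sitesS !sweep_dn_cat /= dn1_sweep_up //; last exact: side'.
by rewrite IHM ?(ltnW ltM) // diag_dn1_up1 // sweep_dn_up1 //; apply: side.
Qed.

Lemma sweep_EH f M phi : (M + n <= L)%N ->
  (forall N, f N * (1 + x * y * q ^+ (2 * N)) = f N.+1) ->
  diag f M (sweep_dn y (sites true M) (sweep_up x (sites false M) phi)) =
  sweep_up x (sites false M) (sweep_dn y (sites true M) (diag f 0 phi)).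
Proof.
move=> leM fE; elim: M leM phi => // M IHM leM phi; have ltM : (M + n < L)%N by lia.
rewrite !sitesS !sweep_up_cat /= sweep_dn_up1 //; last exact: side.
rewrite diag_dn1_up1_rev // IHM ?(ltnW ltM) // dn1_sweep_up //; exact: side'.
Qed.

End Sweeps.

(** * Transposition of sweeps *)

Section Pairing.
Variables (n L : nat).
Hypothesis n_gt0 : (0 < n)%N.
Variables (K : comNzRingType) (q : K).
Notation state := (state L).
Implicit Types (phi psi : state -> K) (w : seq (K * bool)).

Definition pairing phi psi := \sum_s phi s * psi s.

(** Substituting [move b s] for [s] swaps the occupancy tests of [up] and [dn] and preserves the
    exponent [btw]. *)
Lemma pairing_up1 x b phi psi : (b + n < L)%N ->
  pairing (up1 n q x b phi) psi = pairing phi (dn1 n q x b psi).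
Proof.
move=> ltb; rewrite /pairing /up1 /dn1.
under eq_bigr => s do rewrite mulrDl.
under [RHS]eq_bigr => s do rewrite mulrDr.
rewrite !big_split /=; congr (_ + _).
rewrite (reindex_inj (inv_inj (moveK n_gt0 ltb))) /=; apply: eq_bigr => s _.
rewrite /up /dn occ_move1 // occ_move2 // btw_move // moveK // andbC.
by case: ifP => _; rewrite ?mulr0 ?mul0r //; ring.
Qed.

Lemma pairing_sweep x l phi psi : {in l, forall b, b + n < L}%N ->
  pairing (sweep_up n q x l phi) psi = pairing phi (sweep_dn n q x l psi).
Proof.
elim: l phi => //= b l IHl phi ltl.
rewrite IHl ?pairing_up1 ?ltl ?mem_head // => c lc.
by apply: ltl; rewrite in_cons lc orbT.
Qed.

Definition word_up w phi :=
  foldl (fun phi e => sweep_up n q e.1 (sites e.2 (L - n)) phi) phi w.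
Definition word_dn w phi :=
  foldr (fun e phi => sweep_dn n q e.1 (sites e.2 (L - n)) phi) phi w.

Lemma pairing_word w phi psi : pairing (word_up w phi) psi = pairing phi (word_dn w psi).
Proof.
elim: w phi => //= e w IHw phi; rewrite IHw pairing_sweep // => b.
by rewrite mem_sites; lia.
Qed.

End Pairing.


(** * Exchange of sweeps up to terms of high degree *)

Section Order.
Variables (I : finType) (R : comNzRingType).
Implicit Types (f g : fps I R).

Definition ordge k f := forall m, (mdeg m < k)%N -> f m = 0.

Lemma ordgeW j k f : (j <= k)%N -> ordge k f -> ordge j f.
Proof. by move=> jk fk m mj; apply: fk; lia. Qed.

Lemma ordgeD k f g : ordge k f -> ordge k g -> ordge k (f + g).
Proof. by move=> fk gk m mk; rewrite fps_coefD fk // gk // addr0. Qed.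

Lemma ordgeN k f : ordge k f -> ordge k (- f).
Proof. by move=> fk m mk; rewrite fps_coefN fk // oppr0. Qed.

Lemma ordgeM j k f g : ordge j f -> ordge k g -> ordge (j + k) (f * g).
Proof.
move=> fj gk m mjk; rewrite fps_coefM big1 // => -[[a ?] [b ?]] /= /eqP mE.
move: mjk; rewrite mE mdegD => mjk.
case: (ltnP (mdeg a) j) => [/fj-> |ja]; first by rewrite mul0r.
by rewrite gk ?mulr0 //; lia.
Qed.

Lemma ordgeMl k f g : ordge k g -> ordge k (f * g).
Proof. exact: (@ordgeM 0). Qed.

Lemma ordge_sum k (J : Type) (r : seq J) (P : pred J) (F : J -> fps I R) :
  (forall j, P j -> ordge k (F j)) -> ordge k (\sum_(j <- r | P j) F j).
Proof.
by move=> Fk; elim/big_rec: _ => // j f Pj fk; apply: ordgeD => //; apply: Fk.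
Qed.

End Order.

Lemma fps_unit1 (I : finType) (R : comUnitRingType) (f : fps I R) :
  f 0%MM = 0 -> 1 + f \is a GRing.unit.
Proof.
move=> f0; apply/unitrPr; exists (fps_geom (- f)).
by rewrite -[X in 1 + X]opprK fps_geomP // fps_coefN f0 oppr0.
Qed.

Section Truncation.
Variables (n L A c : nat).
Hypothesis n_gt0 : (0 < n)%N.
Variables (I : finType) (R : comUnitRingType).
Notation K := (fps I R).
Variable (q : K).
Notation state := (state L).
Notation up1 := (@up1 n L K q).
Notation dn1 := (@dn1 n L K q).
Notation diag := (@diag n L K).
Notation sweep_up := (@sweep_up n L K q).
Notation sweep_dn := (@sweep_dn n L K q).
Implicit Types (phi psi : state -> K) (x y : K) (f g : nat -> K) (l : seq nat) (s : state).

(* Adding k ribbons to a partition with at most c boxes only affects the sites at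
   distance at most c + n k of the origin A. *)
Definition fit k s :=
  (forall p, (p + c + n * k < A)%N -> occ s p) /\
  (forall p, (A + c + n * k <= p)%N -> ~~ occ s p).

(** Being out of reach of [k] added ribbons costs at least [k + 1] variables. This invariant of all
    the sweeps controls the error made at the ends of the window. *)
Definition good phi := forall k s, ~ fit k s -> ordge k.+1 (phi s).

Lemma good_up1 x b phi : (b + n < L)%N -> ordge 1 x -> good phi -> good (up1 x b phi).
Proof.
move=> ltb x1 gphi k s nfit; rewrite /up1; apply: ordgeD; first exact: gphi.
rewrite /up; case: ifP => [/andP[sb sbn]|_]; last by rewrite mulr0.
rewrite mulrA [x * _]mulrC -mulrA; apply: ordgeMl.
case: k nfit => [_|k nfit]; first by rewrite mulrC; apply: ordgeMl.
apply: (@ordgeM _ _ 1 k.+1) => //; apply: gphi => -[fitl fitr].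
apply: nfit; split=> p ltp.
- have [pE|/eqP pb] := eqVneq p b.
    have := fitl (b + n)%N; rewrite occ_move2 // (negPf sb) => H.
    by suff: false by []; apply: H; lia.
  have [->//|/eqP pbn] := eqVneq p (b + n)%N.
  by rewrite -(occ_move_neq n_gt0 s ltb pb pbn) fitl //; lia.
- have [->//|/eqP pb] := eqVneq p b.
  have [pE|/eqP pbn] := eqVneq p (b + n)%N.
    by have := fitr b; rewrite occ_move1 // sbn => H; suff: false by []; apply: H; lia.
  by rewrite -(occ_move_neq n_gt0 s ltb pb pbn) fitr //; lia.
Qed.

(** If the larger state fits, its hole at [b] and its bead at [b + n] both lie in the range, so
    exchanging them keeps the fit. *)
Lemma good_dn1 y b phi : (b + n < L)%N -> good phi -> good (dn1 y b phi).
Proof.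
move=> ltb gphi k s nfit; rewrite /dn1; apply: ordgeD; first exact: gphi.
rewrite /dn; case: ifP => [/andP[sb sbn]|_]; last by rewrite mulr0.
rewrite mulrA; apply: ordgeMl; apply: gphi => -[fitl fitr].
apply: nfit; split=> p ltp.
- have [->//|/eqP pb] := eqVneq p b.
  have [pE|/eqP pbn] := eqVneq p (b + n)%N.
    by have := fitl b; rewrite occ_move1 // (negPf sbn) => H; suff: false by []; apply: H; lia.
  by rewrite -(occ_move_neq n_gt0 s ltb pb pbn) fitl //; lia.
- have [pE|/eqP pb] := eqVneq p b.
    by have := fitr (b + n)%N; rewrite occ_move2 // sb => H; suff: false by []; apply: H; lia.
  have [->//|/eqP pbn] := eqVneq p (b + n)%N.
  by rewrite -(occ_move_neq n_gt0 s ltb pb pbn) fitr //; lia.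
Qed.

Lemma good_sweep_up x l phi : {in l, forall b, b + n < L}%N -> ordge 1 x ->
  good phi -> good (sweep_up x l phi).
Proof.
move=> + x1; elim: l phi => //= b l IHl phi ltl gphi.
apply: IHl => [c' lc|]; first by apply: ltl; rewrite in_cons lc orbT.
by apply: good_up1 => //; apply: ltl; rewrite mem_head.
Qed.

Lemma good_sweep_dn y l phi : {in l, forall b, b + n < L}%N ->
  good phi -> good (sweep_dn y l phi).
Proof.
elim: l phi => //= b l IHl phi ltl gphi.
apply: good_dn1; first by apply: ltl; rewrite mem_head.
by apply: IHl => // c' lc; apply: ltl; rewrite in_cons lc orbT.
Qed.

Variable d : nat.

Definition cong phi psi := forall s, ordge d.+1 (phi s - psi s).

Lemma cong_refl phi : cong phi phi.
Proof. by move=> s; rewrite subrr. Qed.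

Lemma cong_trans psi phi chi : cong phi psi -> cong psi chi -> cong phi chi.
Proof.
by move=> c1 c2 s; rewrite -[_ - _](subrKA (psi s)); apply: ordgeD.
Qed.

Lemma cong_sym phi psi : cong phi psi -> cong psi phi.
Proof. by move=> c1 s; rewrite -opprB; apply: ordgeN. Qed.

Lemma cong_scale (a : K) phi psi :
  cong phi psi -> cong (fun s => a * phi s) (fun s => a * psi s).
Proof. by move=> c1 s; rewrite -mulrBr; apply: ordgeMl. Qed.

Lemma cong_up1 x b phi psi : cong phi psi -> cong (up1 x b phi) (up1 x b psi).
Proof.
move=> c1 s; rewrite /up1 opprD addrACA -mulrBr; apply: ordgeD => //.
apply: ordgeMl; rewrite /up; case: ifP => _; last by rewrite subrr.
by rewrite -mulrBr; apply: ordgeMl.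
Qed.

Lemma cong_dn1 x b phi psi : cong phi psi -> cong (dn1 x b phi) (dn1 x b psi).
Proof.
move=> c1 s; rewrite /dn1 opprD addrACA -mulrBr; apply: ordgeD => //.
apply: ordgeMl; rewrite /dn; case: ifP => _; last by rewrite subrr.
by rewrite -mulrBr; apply: ordgeMl.
Qed.

Lemma cong_sweep_up x l phi psi : cong phi psi -> cong (sweep_up x l phi) (sweep_up x l psi).
Proof. by elim: l phi psi => //= b l IHl phi psi c1; apply: IHl; apply: cong_up1. Qed.

Lemma cong_sweep_dn x l phi psi : cong phi psi -> cong (sweep_dn x l phi) (sweep_dn x l psi).
Proof. by elim: l phi psi => //= b l IHl phi psi c1; apply: cong_dn1; apply: IHl. Qed.

Lemma sweep_up_scale x l a phi :
  sweep_up x l (fun s => a * phi s) = fun s => a * sweep_up x l phi s.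
Proof.
elim: l phi => //= b l IHl phi; rewrite -IHl; congr sweep_up; apply/funext => s.
by rewrite /up1 /up; case: ifP => _; ring.
Qed.

Lemma sweep_dn_scale x l a phi :
  sweep_dn x l (fun s => a * phi s) = fun s => a * sweep_dn x l phi s.
Proof.
elim: l phi => //= b l IHl phi; rewrite IHl; apply/funext => s.
by rewrite /dn1 /dn; case: ifP => _; ring.
Qed.

(** Room on both sides of the reach of [d] ribbons: the [n] lowest sites stay occupied and the [n]
    highest stay empty, so the end blocks hold [n] and 0 beads. *)
Hypothesis leA : (n + c + n * d <= A)%N.
Hypothesis leL : (A + c + n * d + n <= L)%N.

Lemma blk_right s : fit d s -> blk n s (L - n) = 0%N.
Proof.
case=> _ fitr; apply: big1 => p _; case: andP => // -[/andP[geb _] sp].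
by move: (fitr p) sp => /implyP; case: (occ s p) => //; rewrite implybF; lia.
Qed.

Lemma blk_left s : fit d s -> blk n s 0 = n.
Proof.
case=> fitl _; rewrite /blk /count.
have leL' : (n <= L)%N by lia.
rewrite -[RHS]muln1 -[in RHS](card_ord n) -sum_nat_const (big_ord_widen L (fun=> 1%N)) //.
rewrite [RHS]big_mkcond /=; apply: eq_bigr => p _; rewrite add0n.
by case: ltnP => //= ltp; rewrite fitl //; lia.
Qed.

(** On states that fit the block count is constant; on the others [phi] itself has order above
    [d]. *)
Lemma cong_diag f phi N (m : nat) : good phi -> (forall s, fit d s -> blk n s m = N) ->
  cong (diag f m phi) (fun s => f N * phi s).
Proof.
move=> gphi blkm s; rewrite /diag; have [fs|nfs] := pselect (fit d s).
  by rewrite blkm // subrr.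
by rewrite -mulrBl; apply: ordgeMl; apply: gphi.
Qed.

Lemma cong_diag1 f phi N (m : nat) : f N = 1 -> good phi ->
  (forall s, fit d s -> blk n s m = N) -> cong (diag f m phi) phi.
Proof.
move=> fN gphi blkm; have := cong_diag f gphi blkm; rewrite fN.
by congr cong; apply/funext => s; rewrite mul1r.
Qed.

(* The booleans tell whether the two sweeps are vertical. *)
Definition exchange_factor (v1 v2 : bool) x y : K :=
  if v1 == v2 then (\prod_(t < n) (1 - x * y * q ^+ (2 * t)))^-1
  else \prod_(t < n) (1 + x * y * q ^+ (2 * t)).

Section Exchange.
Variables (x y : K).
Hypotheses (x1 : ordge 1 x) (y1 : ordge 1 y).

Lemma unit_factor (e : bool) N :
  1 + (-1) ^+ e * (x * y * q ^+ (2 * N)) \is a GRing.unit.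
Proof.
apply: fps_unit1; have : ordge 1 ((-1) ^+ e * (x * y * q ^+ (2 * N))).
  by apply: ordgeMl; rewrite mulrC; apply: ordgeMl; apply: ordgeMl.
by apply; rewrite mdeg0.
Qed.

Lemma unit_factorN N : 1 - x * y * q ^+ (2 * N) \is a GRing.unit.
Proof. by have := unit_factor true N; rewrite expr1 mulN1r. Qed.

Lemma unit_factorP N : 1 + x * y * q ^+ (2 * N) \is a GRing.unit.
Proof. by have := unit_factor false N; rewrite expr0 mul1r. Qed.

(** The products [fN], [fP] or their inverses solve the recurrences of the four sweep identities.
    They are 1 at the empty end of the window, so only the value at [n] from the full end
    survives. *)
Lemma exchange v1 v2 phi : good phi ->
  cong (sweep_dn y (sites v2 (L - n)) (sweep_up x (sites v1 (L - n)) phi))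
       (fun s => exchange_factor v1 v2 x y *
          sweep_up x (sites v1 (L - n)) (sweep_dn y (sites v2 (L - n)) phi) s).
Proof.
move=> gphi; have leM : (L - n + n <= L)%N by lia.
have sitesL v : {in sites v (L - n), forall b, b + n < L}%N.
  by move=> b; rewrite mem_sites; lia.
have gU v phi' : good phi' -> good (sweep_up x (sites v (L - n)) phi').
  by move=> ?; apply: good_sweep_up.
have gD v phi' : good phi' -> good (sweep_dn y (sites v (L - n)) phi').
  by move=> ?; apply: good_sweep_dn.
pose fN N := \prod_(t < N) (1 - x * y * q ^+ (2 * t)).
pose fP N := \prod_(t < N) (1 + x * y * q ^+ (2 * t)).
have fNS N : fN N * (1 - x * y * q ^+ (2 * N)) = fN N.+1 by rewrite /fN big_ord_recr.
have fPS N : fP N * (1 + x * y * q ^+ (2 * N)) = fP N.+1 by rewrite /fP big_ord_recr.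
have fNU N : fN N \is a GRing.unit.
  elim: N => [|N IH]; first by rewrite /fN big_ord0 unitr1.
  by rewrite -fNS unitrM IH unit_factorN.
have fPU N : fP N \is a GRing.unit.
  elim: N => [|N IH]; first by rewrite /fP big_ord0 unitr1.
  by rewrite -fPS unitrM IH unit_factorP.
have fNV N : (fN N.+1)^-1 * (1 - x * y * q ^+ (2 * N)) = (fN N)^-1.
  by rewrite -fNS invrM ?unit_factorN // mulrAC mulVr ?mul1r // unit_factorN.
have fPV N : (fP N.+1)^-1 * (1 + x * y * q ^+ (2 * N)) = (fP N)^-1.
  by rewrite -fPS invrM ?unit_factorP // mulrAC mulVr ?mul1r // unit_factorP.
have f0 : fN 0%N = 1 by rewrite /fN big_ord0.
have f0' : fP 0%N = 1 by rewrite /fP big_ord0.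
rewrite /exchange_factor -/(fN n) -/(fP n); case: v1 v2 => [] [] /=.
- have E := @sweep_EE n L n_gt0 K q x y fN _ phi leM fNS.
  have c1 : cong (fun s => fN n * sweep_dn y (sites true (L - n))
      (sweep_up x (sites true (L - n)) phi) s)
      (sweep_up x (sites true (L - n)) (sweep_dn y (sites true (L - n)) phi)).
    rewrite -sweep_dn_scale; apply: (@cong_trans (sweep_dn y (sites true (L - n))
      (diag fN 0 (sweep_up x (sites true (L - n)) phi)))).
      apply: cong_sweep_dn; apply: cong_sym; apply: cong_diag; first exact: gU.
      exact: blk_left.
    rewrite E; apply: cong_sweep_up.
    by apply: (cong_diag1 f0); [exact: gD|exact: blk_right].
  have := cong_scale (fN n)^-1 c1; congr cong; apply/funext => s.
  by rewrite mulrA mulVr // mul1r.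
- have E := @sweep_HE n L n_gt0 K q x y (fun N => (fP N)^-1) _ phi leM fPV.
  have c1 : cong (fun s => (fP n)^-1 * sweep_dn y (sites false (L - n))
      (sweep_up x (sites true (L - n)) phi) s)
      (sweep_up x (sites true (L - n)) (sweep_dn y (sites false (L - n)) phi)).
    apply: (@cong_trans (diag (fun N => (fP N)^-1) 0 (sweep_dn y (sites false (L - n))
      (sweep_up x (sites true (L - n)) phi)))).
      apply: cong_sym; apply: (@cong_diag (fun N => (fP N)^-1)).
        by apply: gD; apply: gU.
      exact: blk_left.
    rewrite E; apply: cong_sweep_up; apply: cong_sweep_dn.
    by apply: (@cong_diag1 (fun N => (fP N)^-1) _ 0); rewrite ?f0' ?invr1 //; exact: blk_right.
  have := cong_scale (fP n) c1; congr cong; apply/funext => s.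
  by rewrite mulrA divrr // mul1r.
- have E := @sweep_EH n L n_gt0 K q x y fP _ phi leM fPS.
  apply: (@cong_trans (diag fP (L - n) (sweep_dn y (sites true (L - n))
      (sweep_up x (sites false (L - n)) phi)))).
    by apply/cong_sym/(cong_diag1 f0'); [exact/gD/gU|exact: blk_right].
  rewrite E -sweep_up_scale; apply: cong_sweep_up; rewrite -sweep_dn_scale.
  by apply: cong_sweep_dn; apply: cong_diag; [|exact: blk_left].
- have E := @sweep_HH n L n_gt0 K q x y (fun N => (fN N)^-1) _ phi leM fNV.
  apply: (@cong_trans (sweep_dn y (sites false (L - n)) (diag (fun N => (fN N)^-1) (L - n)
      (sweep_up x (sites false (L - n)) phi)))).
    apply/cong_sweep_dn/cong_sym/(@cong_diag1 (fun N => (fN N)^-1) _ 0).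
    - by rewrite f0 invr1.
    - exact: gU.
    - exact: blk_right.
  rewrite E -sweep_up_scale; apply: cong_sweep_up.
  by apply: (@cong_diag (fun N => (fN N)^-1)); [exact: gD|exact: blk_left].
Qed.

End Exchange.

Notation word_up := (@word_up n L K q).
Notation word_dn := (@word_dn n L K q).
Implicit Types w : seq (K * bool).

Lemma good_word_dn w phi : good phi -> good (word_dn w phi).
Proof.
move=> gphi; elim: w => //= e w IHw.
by apply: good_sweep_dn => [b|//]; rewrite mem_sites; lia.
Qed.

Lemma word_up_scale w a phi :
  word_up w (fun s => a * phi s) = fun s => a * word_up w phi s.
Proof. by elim: w phi => //= e w IHw phi; rewrite sweep_up_scale IHw. Qed.

Lemma cong_word_up w phi psi : cong phi psi -> cong (word_up w phi) (word_up w psi).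
Proof. by elim: w phi psi => //= e w IHw phi psi ?; apply: IHw; apply: cong_sweep_up. Qed.

Lemma exchange_dn_word w e phi : {in w, forall e, ordge 1 e.1} -> ordge 1 e.1 -> good phi ->
  cong (sweep_dn e.1 (sites e.2 (L - n)) (word_up w phi))
   (fun s => \prod_(e' <- w) exchange_factor e'.2 e.2 e'.1 e.1 *
      word_up w (sweep_dn e.1 (sites e.2 (L - n)) phi) s).
Proof.
move=> + e1; elim: w phi => /= [|e' w IHw] phi w1 gphi.
  move=> s; rewrite big_nil mul1r; exact: cong_refl.
have e'1 : ordge 1 e'.1 by apply: w1; rewrite mem_head.
have {}w1 : {in w, forall e, ordge 1 e.1}.
  by move=> e2 we2; apply: w1; rewrite in_cons we2 orbT.
have gU : good (sweep_up e'.1 (sites e'.2 (L - n)) phi).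
  by apply: good_sweep_up => // b; rewrite mem_sites; lia.
apply: cong_trans (IHw _ w1 gU) _.
have c1 := cong_word_up w (exchange e'1 e1 e'.2 e.2 gphi).
have := cong_scale (\prod_(e' <- w) exchange_factor e'.2 e.2 e'.1 e.1) c1.
congr cong; apply/funext => s; rewrite word_up_scale big_cons.
by ring.
Qed.

Lemma exchange_word w1 w2 phi : {in w1, forall e, ordge 1 e.1} ->
  {in w2, forall e, ordge 1 e.1} -> good phi ->
  cong (word_dn w2 (word_up w1 phi))
   (fun s => \prod_(e2 <- w2) \prod_(e1 <- w1) exchange_factor e1.2 e2.2 e1.1 e2.1 *
      word_up w1 (word_dn w2 phi) s).
Proof.
move=> + + gphi; move=> w1o; elim: w2 => /= [|e w IHw] w2o.
  move=> s; rewrite big_nil mul1r; exact: cong_refl.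
have eo : ordge 1 e.1 by apply: w2o; rewrite mem_head.
have {}w2o : {in w, forall e, ordge 1 e.1}.
  by move=> e2 we2; apply: w2o; rewrite in_cons we2 orbT.
apply: (cong_trans (cong_sweep_dn _ _ (IHw w2o))); rewrite sweep_dn_scale.
have := cong_scale (\prod_(e2 <- w) \prod_(e1 <- w1) exchange_factor e1.2 e2.2 e1.1 e2.1)
  (exchange_dn_word w1o eo (good_word_dn w gphi)).
by congr cong; apply/funext => s; rewrite big_cons; ring.
Qed.

Variable s0 : state.
Hypothesis fit0 : fit 0 s0.
Hypothesis core0 : forall b, (b + n < L)%N -> occ s0 (b + n) -> occ s0 b.

Definition vacuum : state -> K := fun s => (s == s0)%:R.

Lemma good_vacuum : good vacuum.
Proof.
move=> k s nfit; rewrite /vacuum; case: eqP => // sE; case: nfit; rewrite sE.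
by case: fit0 => fl fr; split=> p ltp; [apply: fl|apply: fr]; lia.
Qed.

(** [dn b vacuum] lives on the states obtained from [s0] by removing a ribbon, and a core has
    none. *)
Lemma word_dn_vacuum w : word_dn w vacuum = vacuum.
Proof.
elim: w => //= e w ->; have: {in sites e.2 (L - n), forall b, b + n < L}%N.
  by move=> b; rewrite mem_sites; lia.
elim: sites => //= b l IHl ltl; rewrite IHl; last first.
  by move=> c' lc; apply: ltl; rewrite in_cons lc orbT.
have ltb : (b + n < L)%N by apply: ltl; rewrite mem_head.
apply/funext => s; rewrite /dn1 /dn; case: ifP => [/andP[sb sbn]|_]; last first.
  by rewrite mulr0 addr0.
rewrite [X in _ * (_ * X)]/vacuum; case: eqP => [sE|_]; last by rewrite !mulr0 addr0.
move: (core0 ltb); rewrite -sE occ_move1 // occ_move2 // sb => /(_ isT) sbn'.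
by rewrite sbn' in sbn.
Qed.

Lemma pairing_vacuum phi : pairing vacuum phi = phi s0.
Proof.
rewrite /pairing (bigD1 s0) //= /vacuum eqxx mul1r big1 ?addr0 // => s /negPf ->.
by rewrite mul0r.
Qed.

Lemma word_up_vacuum w : word_up w vacuum s0 = 1.
Proof.
rewrite -pairing_vacuum /pairing; under eq_bigr => s do rewrite mulrC.
rewrite -/(pairing _ _) pairing_word // word_dn_vacuum pairing_vacuum /vacuum.
by rewrite eqxx.
Qed.

Theorem pairing_words w1 w2 : {in w1, forall e, ordge 1 e.1} ->
  {in w2, forall e, ordge 1 e.1} ->
  ordge d.+1 (pairing (word_up w1 vacuum) (word_up w2 vacuum) -
    \prod_(e2 <- w2) \prod_(e1 <- w1) exchange_factor e1.2 e2.2 e1.1 e2.1).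
Proof.
move=> w1o w2o; have -> : pairing (word_up w1 vacuum) (word_up w2 vacuum) =
    pairing (word_up w2 vacuum) (word_up w1 vacuum).
  by apply: eq_bigr => s _; rewrite mulrC.
rewrite pairing_word // pairing_vacuum.
have := exchange_word w1o w2o good_vacuum s0.
by rewrite word_dn_vacuum word_up_vacuum mulr1.
Qed.

End Truncation.

Local Open Scope nat_scope.

(** * Bead configurations of partitions *)

Section Beads.
Variable L : nat.
Notation state := (state L).
Implicit Types (s : state) (c : nat).

Definition cnt s c := count s (fun p => c <= p).

Lemma cnt_ge s c : L <= c -> cnt s c = 0.
Proof. by move=> leL; apply: big1 => p _; have := ltn_ord p; case: leqP => //; lia. Qed.

Lemma cntS s c : cnt s c = occ s c + cnt s c.+1.
Proof.
have [leL|ltL] := leqP L c; first by rewrite !cnt_ge ?occ_ge // leqW.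
have := @sum_diff1 L (fun p => (c <= p) && occ s p : nat)
  (fun p => (c.+1 <= p) && occ s p : nat) c ltL.
rewrite leqnn ltnn /= addn0 /cnt /count => ->; first by rewrite addnC.
by move=> p pc; congr (nat_of_bool (_ && _)); lia.
Qed.

Lemma cnt_step s c : cnt s c.+1 <= cnt s c <= (cnt s c.+1).+1.
Proof. by rewrite (cntS s c); case: (occ s c); lia. Qed.

Lemma cnt_lower s A c : cnt s 0 = A -> A <= c + cnt s c.
Proof. by move=> sA; elim: c => [|c]; [lia|have := cnt_step s c; lia]. Qed.

Lemma cnt_le s A c : cnt s 0 = A -> cnt s c <= A.
Proof. by move=> <-; apply: (height_mono (cnt_step s)). Qed.

Lemma cnt_inj s s' : cnt s =1 cnt s' -> s = s'.
Proof.
move=> E; apply: occ_inj => p; have := cntS s p; have := cntS s' p; rewrite !E.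
by case: (occ s p); case: (occ s' p); lia.
Qed.

Variable A : nat.

(* With A beads, row i of [lam] is the bead at position lam_i + A - 1 - i; box
   (i, j) lies in [lam] iff this position is at least j + A - i. For i > j + A the
   subtraction is truncated, which is harmless as [cnt s 0 = A]. *)
Definition shape s (lam : intpart) :=
  forall i j, ((i, j) \in young lam) = (i < cnt s (j + A - i)).

Lemma shape_at s lam i c : shape s lam -> i < A -> A <= c + i ->
  ((i, c + i - A) \in young lam) = (i < cnt s c).
Proof. by move=> shs iA Ac; rewrite shs; congr (_ < cnt s _); lia. Qed.

Lemma shape_in s lam i j : cnt s 0 = A -> shape s lam -> (i, j) \in young lam ->
  i < A /\ j + A < L + i.
Proof.
move=> sA shs; rewrite shs => lti; have := cnt_le (j + A - i) sA.
have [leL|] := leqP L (j + A - i); first by rewrite cnt_ge in lti.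
by lia.
Qed.

Lemma shape_part s : cnt s 0 = A -> exists lam, shape s lam.
Proof.
move=> sA; pose Y : boxes := [fset b in [seq (i, j) | i <- iota 0 A, j <- iota 0 L] |
  b.1 < cnt s (b.2 + A - b.1)].
have YP i j : ((i, j) \in Y) = (i < cnt s (j + A - i)).
  rewrite !inE /=; apply/andP/idP => [[_ ->//]|lti]; split=> //.
  have := cnt_le (j + A - i) sA.
  have [leL|ltL] := leqP L (j + A - i); first by rewrite cnt_ge in lti.
  move=> leA; apply/allpairsPdep; exists i, j; rewrite !mem_iota; split=> //; lia.
have [|lam lamE] := @ideal_young Y; last by exists lam => i j; rewrite lamE.
move=> i j; rewrite !YP; split=> lti.
  have leA := cnt_le (j + A - i.+1) sA; have := cnt_step s (j + A - i.+1).
  have E : (j + A - i.+1).+1 = j + A - i by lia.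
  by rewrite E; lia.
have leA := cnt_le (j.+1 + A - i) sA.
have := cnt_step s (j + A - i).
have E : (j + A - i).+1 = j.+1 + A - i by lia.
by rewrite E; lia.
Qed.

Lemma shape_state lam : A <= L -> (forall i j, (i, j) \in young lam -> i < A /\ j + A < L) ->
  exists2 s, cnt s 0 = A & shape s lam.
Proof.
(* [Phi c i] says that the box of row [i] and content [c - A] lies in the diagram extended by all
   negative columns. The number [g c] of such rows is the bead count to be realised, so a bead sits
   wherever [g] drops. *)
move=> AL lamP; pose Phi c i := (i < A) && ((c + i < A) || ((i, c + i - A) \in young lam)).
have exg c : exists i, ~~ Phi c i by exists A; rewrite /Phi ltnn.
pose g c := ex_minn (exg c).
have PhiS c i : Phi c i.+1 -> Phi c.+1 i.
  rewrite /Phi => /andP[ltA]; rewrite (ltnW ltA) addSn addnS => /orP[->//|].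
  by move=> /(@young_ideal lam _ _).1 ->; rewrite orbT.
have PhiW c i : Phi c.+1 i -> Phi c i.
  rewrite /Phi => /andP[-> /orP[lt|]]; first by rewrite (ltnW lt).
  case: (ltnP (c + i) A) => //= ge; rewrite addSn subSn //.
  exact: (@young_ideal lam _ _).2.
have gP c i : (i < g c) = Phi c i.
  rewrite /g; case: ex_minnP => m nm minm; apply/idP/idP => [ltm|ci].
    by apply: contraTT ltm => /minm; rewrite -leqNgt.
  rewrite ltnNge; apply: contra nm => lem.
  move: ci; rewrite -(subnK lem); elim: (i - m) => // k IHk; rewrite addSn => H.
  by apply: IHk; apply/PhiW/PhiS.
have gS c : g c.+1 <= g c <= (g c.+1).+1.
  apply/andP; split.
    case: (posnP (g c.+1)) => [->//|g0]; rewrite -(ltn_predK g0) gP; apply: PhiW.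
    by rewrite -gP (ltn_predK g0).
  case: (ltnP (g c) 2) => [|g2]; first by lia.
  have gE : (g c).-2.+2 = g c by lia.
  by rewrite -gE ltnS gP; apply: PhiS; rewrite -gP gE.
have gL : g L = 0.
  apply/eqP; rewrite -leqn0 leqNgt gP /Phi addn0 [L < A]ltnNge AL /=.
  by apply/negP => /andP[_ /lamP]; lia.
have g0 : g 0 = A.
  apply/eqP; rewrite eqn_leq; apply/andP; split; first by rewrite leqNgt gP /Phi ltnn.
  case: (posnP A) => [->//|A0]; rewrite -(ltn_predK A0) gP /Phi add0n.
  by rewrite (ltn_predK A0) leqnn.
pose s := mkstate L (fun p => g p.+1 < g p).
have cE c : cnt s c = g c.
  have [leL|ltL] := leqP L c.
    rewrite cnt_ge //; apply/esym/eqP; rewrite -leqn0 -gL; exact: (height_mono gS).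
  have [k kE] : exists k, c + k = L by exists (L - c); lia.
  elim: k c {ltL} kE => [|k IHk] c kE; first by rewrite addn0 in kE; rewrite kE gL cnt_ge.
  rewrite cntS IHk ?addSnnS // occ_mkstate; last by lia.
  by have := gS c; lia.
exists s; first by rewrite cE.
move=> i j; rewrite cE gP /Phi; case: (ltnP i A) => iA /=.
  have -> : j + A - i + i = j + A by lia.
  by rewrite ltnNge leq_addl /= addnK.
by apply/negP => /lamP []; lia.
Qed.

Lemma shape_cnt_le s s' lam lam' : cnt s 0 = A -> cnt s' 0 = A -> shape s lam ->
  shape s' lam' -> young lam `<=` young lam' -> forall c, cnt s c <= cnt s' c.
Proof.
move=> sA sA' shs shs' /fsubsetP sub c; rewrite leqNgt; apply/negP => lt.
have ltA : cnt s' c < A by have := cnt_le c sA; lia.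
have := sub (cnt s' c, c + cnt s' c - A); rewrite !(shape_at shs, shape_at shs') //;
  try exact: cnt_lower.
by rewrite lt ltnn => /(_ isT).
Qed.

Lemma shape_inj s s' lam : cnt s 0 = A -> cnt s' 0 = A -> shape s lam -> shape s' lam -> s = s'.
Proof.
move=> sA sA' sh sh'; apply: cnt_inj => c.
by apply/eqP; rewrite eqn_leq !(@shape_cnt_le _ _ lam lam).
Qed.

Lemma shape_uniq s lam lam' : shape s lam -> shape s lam' -> lam = lam'.
Proof. by move=> sh sh'; apply: young_inj; apply/fsetP => -[i j]; rewrite sh sh'. Qed.

Variable n : nat.
Hypothesis n_gt0 : 0 < n.

Lemma cnt_move s b c : b + n < L -> ~~ occ s b -> occ s (b + n) ->
  cnt s c = cnt (move n b s) c + (b < c <= b + n).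
Proof.
move=> ltb sb sbn; have := count_move n_gt0 s (fun p => c <= p) ltb.
rewrite -/(cnt _ _) -/(cnt s c) sbn (negPf sb) !andbT !andbF.
by case: (leqP c b); case: (leqP c (b + n)) => /=; lia.
Qed.

Lemma cnt_move0 s b : b + n < L -> ~~ occ s b -> occ s (b + n) -> cnt (move n b s) 0 = cnt s 0.
Proof. by move=> ltb sb sbn; rewrite (cnt_move 0 ltb sb sbn) addn0. Qed.

Lemma btwE s b : b + n < L -> btw n s b = cnt s b.+1 - cnt s (b + n).
Proof.
move=> ltb; rewrite /btw /cnt.
suff : count s (fun p => b < p < b + n) + count s (fun p => b + n <= p) =
       count s (fun p => b.+1 <= p) by lia.
rewrite /count -big_split; apply: eq_bigr => p _ /=.
by case: (occ s p); rewrite ?andbF ?andbT //; lia.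
Qed.

(** The bead counts before and after differ by one exactly for [b < c <= b + n]. The removed boxes
    are thus the stairs of the smaller state over these [c], and their row count is read off from
    the counts at [b + 1] and [b + n]. *)
Lemma move_ribbon s b lam nu : cnt s 0 = A -> b + n < L -> ~~ occ s b -> occ s (b + n) ->
  shape s lam -> shape (move n b s) nu ->
  [/\ young nu `<=` young lam, ribbon n (young lam `\` young nu),
      tail_at n (young lam `\` young nu) (b%:Z + 1 - A%:Z)%R &
      ribbon_spin (young lam `\` young nu) = btw n s b].
Proof.
move=> sA ltb sb sbn shs shn; set s' := move n b s in shn.
have cE c : cnt s c = cnt s' c + (b < c <= b + n) by exact: cnt_move.
have sA' : cnt s' 0 = A by rewrite cnt_move0.
have hS := cnt_step s'; have hA c := cnt_lower c sA'.
have sub : young nu `<=` young lam.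
  by apply/fsubsetP => -[i j]; rewrite shs shn cE; lia.
have RE : young lam `\` young nu = stairs (cnt s') A b.+1 n.
  apply/fsetP => -[i j]; rewrite in_fsetD shs shn cE; apply/andP/mem_stairs.
    move=> [ge lt]; have := cnt_le (j + A - i) sA'.
    by exists (j + A - i); [lia|rewrite /stair; congr pair; lia].
  move=> [k kE [iE jE]]; have := hA k => hk; have := cnt_le k sA; rewrite cE => hk'.
  have E : j + A - i = k by lia.
  by rewrite E; lia.
have conn := @stairs_connected _ _ hS hA b.+1 n.
split=> //.
- split; [by exists lam, nu|by rewrite RE|by rewrite RE card_stairs|].
  rewrite RE; exact: stairs_no_square.
- rewrite RE => k; split=> [[x /mem_stairs[c cE' ->] <-]|kE].
    by rewrite content_stair //; lia.
  exists (stair (cnt s') A `|(k + A%:Z)%R|%N); last by rewrite content_stair //; lia.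
  by apply/mem_stairs; exists `|(k + A%:Z)%R|%N => //; lia.
- rewrite RE /ribbon_spin -[in stairs _ _ _ _](prednK n_gt0) rows_stairs //=.
  rewrite btwE // !cE; have -> : b.+1 + n.-1 = b + n by lia.
  by rewrite ltnSn leqnn; lia.
Qed.

(** A ribbon has one box on each of [n] consecutive diagonals, so the bead counts of [lam] and [nu]
    differ by one on an interval of [n] sites and agree elsewhere. Occupancy then changes only at
    the two ends [b] and [b + n]. *)
Lemma ribbon_move s lam nu m : A <= L -> cnt s 0 = A -> shape s lam ->
  (forall i j, (i, j) \in young lam -> j + A < L) ->
  young nu `<=` young lam -> ribbon n (young lam `\` young nu) ->
  tail_at n (young lam `\` young nu) m ->
  exists b, [/\ b + n < L, m = (b%:Z + 1 - A%:Z)%R, ~~ occ s b, occ s (b + n) &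
     shape (move n b s) nu].
Proof.
move=> AL sA shs ltL sub ribR tR; set R := young lam `\` young nu in ribR tR.
have [s' sA' shn] : exists2 s', cnt s' 0 = A & shape s' nu.
  apply: shape_state => // i j /(fsubsetP sub) ijlam; split; last exact: ltL ijlam.
  by have [] := shape_in sA shs ijlam.
have inR i j : ((i, j) \in R) = (cnt s' (j + A - i) <= i < cnt s (j + A - i)).
  by rewrite in_fsetD shs shn -leqNgt.
have le := shape_cnt_le sA' sA shn shs sub.
have boxR c : cnt s' c < cnt s c -> (cnt s' c, c + cnt s' c - A) \in R.
  move=> lt; have := cnt_le c sA; have := cnt_lower c sA' => lo hi; rewrite inR.
  have E : c + cnt s' c - A + A - cnt s' c = c by lia.
  by rewrite E leqnn.
have tP c : cnt s c = cnt s' c + ((m <= c%:Z - A%:Z)%R && (c%:Z - A%:Z < m + n%:Z)%R).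
  have := cnt_le c sA; have := cnt_lower c sA' => lo hi.
  have up : cnt s c <= (cnt s' c).+1.
    rewrite leqNgt; apply/negP => lt2.
    have b1 := boxR c (ltnW lt2).
    have b2 : ((cnt s' c).+1, c + (cnt s' c).+1 - A) \in R.
      have E : c + (cnt s' c).+1 - A + A - (cnt s' c).+1 = c by lia.
      by rewrite inR E; lia.
    suff [] : (cnt s' c, c + cnt s' c - A) = ((cnt s' c).+1, c + (cnt s' c).+1 - A) by lia.
    by apply: (ribbon_content_inj ribR b1 b2); rewrite /content /=; lia.
  have [inI|outI] := boolP (_ && _).
    have [b Rb bE] : exists2 b, b \in R & content b = (c%:Z - A%:Z)%R by apply/tR.
    case: b Rb bE => i j; rewrite inR /content /= => Rij cE.
    have := cnt_le (j + A - i) sA => leA; have E : j + A - i = c by lia.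
    by rewrite E in Rij; lia.
  apply/eqP; rewrite addn0 eqn_leq le andbT leqNgt; apply: contra outI => /boxR.
  by move=> /(tail_at_bound tR); rewrite /content /=; lia.
have [b [bE ltb]] : exists b, m = (b%:Z + 1 - A%:Z)%R /\ b + n < L.
  have [[i j] Rb ctE] := tail_at_min n_gt0 tR.
  have [[i' j'] Rb' ctE'] := tail_at_max n_gt0 tR.
  have [lti _] := shape_in sA shs (fsubsetP (fsubsetDl _ _) _ Rb).
  have [_ ltj] := shape_in sA shs (fsubsetP (fsubsetDl _ _) _ Rb').
  by exists `|(m + A%:Z - 1)%R|%N; move: ctE ctE'; rewrite /content /=; lia.
have {}tP c : cnt s c = cnt s' c + (b < c <= b + n) by rewrite tP; congr (_ + nat_of_bool _); lia.
have oE p : occ s p + (b < p.+1 <= b + n) = occ s' p + (b < p <= b + n).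
  by have := tP p; have := tP p.+1; have := cntS s p; have := cntS s' p; lia.
have ob := oE b; have obn := oE (b + n).
have sb : ~~ occ s b by move: ob; case: (occ s b) => //=; case: (occ s' b); lia.
have sbn : occ s (b + n) by move: obn; case: (occ s (b + n)) => //=; lia.
exists b; split=> //.
suff -> : move n b s = s' by [].
by apply: cnt_inj => c; have := cnt_move c ltb sb sbn; have := tP c; lia.
Qed.

End Beads.

(** * Expansion of words of operators over tableaux *)

Section Expansion.
Variables (n L A p s : nat) (le : rel ('I_p + 'I_s)).
Hypotheses (n_gt0 : 0 < n) (le_order : label_order le).
Notation label := ('I_p + 'I_s)%type.
Notation state := (state L).
Notation shape := (@shape L A).
Implicit Types (T : labelled_ribbons p s) (R : boxes) (l : label) (st : state) (e : label * nat)
  (E : seq (label * nat)) (lam nu : intpart).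

Variable delta : intpart.

(* Content of the tail of the ribbon added by moving the bead at b. *)
Definition tail_of_bead (b : nat) : int := (b%:Z + 1 - A%:Z)%R.

(** Boolean form of [ribbon_lt] on events. Bead positions and tail contents differ by a shift, so
    the two orders agree. *)
Definition event_lt e' e :=
  (le e'.1 e.1 && (e'.1 != e.1)) ||
  ((e'.1 == e.1) && (if vertical_label e.1 then e.2 < e'.2 else e'.2 < e.2)).

Lemma event_lt_irr e : event_lt e e = false.
Proof. by rewrite /event_lt !eqxx andbF /=; case: ifP; rewrite ltnn. Qed.

Lemma event_lt_ribbon e' e : event_lt e' e ->
  ribbon_lt le (e'.1, tail_of_bead e'.2) (e.1, tail_of_bead e.2).
Proof.
case/orP => [H|/andP[/eqP E H]]; [by left|right; split=> //=].
by move: H; rewrite /before /tail_of_bead; case: ifP => _; lia.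
Qed.

(* The event (l, b) is the addition of a ribbon of label l by moving the bead at b. *)
Definition events_in E T := forall R l, (R, l) \in T ->
  exists2 b, (l, b) \in E & tail_at n R (tail_of_bead b).

Definition tabs E lam : {fset labelled_ribbons p s} :=
  [fset T in super_tableaux n le lam delta | `[< events_in E T >]].

Lemma tabsP E lam T :
  reflect (super_tableau n le lam delta T /\ events_in E T) (T \in tabs E lam).
Proof.
rewrite in_fset; apply: (iffP andP) => /= -[].
  by move=> /in_super_tableaux tabT /asboolP.
by move=> tabT evT; split; [apply/in_super_tableaux|apply/asboolP].
Qed.

Lemma tail_of_bead_inj R b b' :
  tail_at n R (tail_of_bead b) -> tail_at n R (tail_of_bead b') -> b = b'.
Proof. by move=> t1 t2; have := tail_at_uniq n_gt0 t1 t2; rewrite /tail_of_bead; lia. Qed.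

Lemma shape_col st lam i j : cnt st 0 = A -> shape st lam -> (i, j) \in young lam ->
  j + A < L.
Proof.
(* The top row gives the column bound of [shape_in] without the slack [i]. *)
move=> stA sh lamij; have lam0j : (0, j) \in young lam.
  by apply: ideal_le lamij _ _ => //; exact: young_ideal.
by have [_] := shape_in stA sh lam0j; rewrite addn0.
Qed.

Section Step.
Variables (E : seq (label * nat)) (e : label * nat).
Hypothesis ltEe : {in E, forall e', event_lt e' e}.

Lemma tabs_old lam : [fset T in tabs (rcons E e) lam | `[< events_in E T >]] = tabs E lam.
Proof.
apply/fsetP => T; rewrite in_fset; apply/andP/tabsP => /= -[].
  by move=> /tabsP[tabT _] /asboolP.
move=> tabT evT; split; last exact/asboolP.
apply/tabsP; split=> // R l Tl; have [b Eb tR] := evT R l Tl; exists b => //.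
by rewrite mem_rcons inE Eb orbT.
Qed.

(** A tableau not covered by [E] uses the event [e], through a single ribbon because tails are
    distinct within one label. As [e] comes after all of [E], this ribbon is the last one and can be
    peeled off. *)
Lemma new_ribbon lam T : T \in [fset T in tabs (rcons E e) lam | ~~ `[< events_in E T >]] ->
  super_tableau n le lam delta T /\ exists R,
    [/\ (R, e.1) \in T, tail_at n R (tail_of_bead e.2),
        (forall R' l' m', (R', l') \in T -> (R', l') <> (R, e.1) -> tail_at n R' m' ->
           ribbon_lt le (l', m') (e.1, tail_of_bead e.2)) &
        events_in E (T `\ (R, e.1))].
Proof.
rewrite in_fset => /andP[/tabsP[tabT evT] /asboolP nev]; split=> //.
have [R [l [Tl nR]]] : exists R l, (R, l) \in T /\
    ~ (exists2 b, (l, b) \in E & tail_at n R (tail_of_bead b)).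
  apply: contrapT => H; apply: nev => R l Tl; apply: contrapT => nR.
  by apply: H; exists R, l.
have [b] := evT R l Tl; rewrite mem_rcons inE => /orP[/eqP eE|Eb tR]; last by case: nR; exists b.
move=> tR; have [l1E b1E] : e.1 = l /\ e.2 = b by rewrite -eE.
exists R; rewrite l1E b1E; split=> // [R' l' m' Tl' neq tR'|R' l'].
  have [b'] := evT R' l' Tl'; rewrite mem_rcons inE -eE.
  move=> /orP[/eqP[l'E b'E]|Eb' tR2]; last first.
    by rewrite (tail_at_uniq n_gt0 tR' tR2); have := event_lt_ribbon (ltEe Eb'); rewrite -eE.
  subst l' b' => tR2; case: neq; congr pair; exact: (tab_uniq n_gt0 tabT Tl' Tl tR2 tR).
rewrite !inE => /andP[neq Tl']; have [b'] := evT R' l' Tl'.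
rewrite mem_rcons inE -eE => /orP[/eqP[l'E b'E]|Eb' tR2]; last by exists b'.
subst l' b' => tR2; case/eqP: neq; congr pair; exact: (tab_uniq n_gt0 tabT Tl' Tl tR2 tR).
Qed.

Hypothesis AL : A <= L.

Lemma new_ribbon_removed st lam T R : cnt st 0 = A -> shape st lam ->
  super_tableau n le lam delta T -> (R, e.1) \in T -> tail_at n R (tail_of_bead e.2) ->
  (forall R' l' m', (R', l') \in T -> (R', l') <> (R, e.1) -> tail_at n R' m' ->
           ribbon_lt le (l', m') (e.1, tail_of_bead e.2)) ->
  exists nu, [/\ super_tableau n le nu delta (T `\ (R, e.1)),
    R = young lam `\` young nu, ~~ occ st e.2, occ st (e.2 + n) & shape (move n e.2 st) nu].
Proof.
move=> stA sh tabT Tl tR lastR.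
have [nu [nuE tabT']] := tab_del n_gt0 le_order tabT Tl tR lastR.
have sub : young nu `<=` young lam by rewrite nuE fsubsetDl.
have RE : R = young lam `\` young nu.
  rewrite nuE; apply/fsetP => b; rewrite !in_fsetD negb_and negbK.
  have := @tab_sub _ _ _ _ _ _ _ tabT _ _ b Tl.
  by case: (b \in R) => [->//|_]; case: (b \in young lam).
have ribR := tab_ribbon tabT Tl; rewrite RE in ribR tR.
have [b [ltb mE sb sbn shn]] := ribbon_move n_gt0 AL stA sh
  (fun i j => shape_col stA sh) sub ribR tR.
have bE : e.2 = b by move: mE; rewrite /tail_of_bead; lia.
by exists nu; rewrite bE.
Qed.

Lemma tabs_new_empty st lam : cnt st 0 = A -> shape st lam ->
  ~~ (~~ occ st e.2 && occ st (e.2 + n)) ->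
  [fset T in tabs (rcons E e) lam | ~~ `[< events_in E T >]] = fset0.
Proof.
move=> stA sh nmv; apply/fsetP => T; rewrite [RHS]in_fset0; apply/negP => /new_ribbon.
move=> [tabT [R [Tl tR lastR _]]].
have [nu [_ _ sb sbn _]] := new_ribbon_removed stA sh tabT Tl tR lastR.
by rewrite sb sbn in nmv.
Qed.

Lemma tabs_new st lam nu : cnt st 0 = A -> shape st lam -> e.2 + n < L ->
  ~~ occ st e.2 -> occ st (e.2 + n) -> shape (move n e.2 st) nu ->
  [fset T in tabs (rcons E e) lam | ~~ `[< events_in E T >]] =
  [fset (young lam `\` young nu, e.1) |` T | T in tabs E nu].
Proof.
move=> stA sh lte sb sbn shn.
have [sub ribR tR _] := move_ribbon n_gt0 stA lte sb sbn sh shn.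
set R := young lam `\` young nu in ribR tR *.
apply/fsetP => T; apply/idP/imfsetP => [/new_ribbon|] /=.
  move=> [tabT [R' [Tl tR' lastR evT]]].
  have [nu' [tabT' RE _ _ shn']] := new_ribbon_removed stA sh tabT Tl tR' lastR.
  have nuE := shape_uniq shn shn'; rewrite -nuE in tabT' RE.
  exists (T `\ (R', e.1)); first by apply/tabsP.
  by rewrite /R -RE fsetD1K.
move=> [T' /tabsP[tabT' evT'] ->].
have lamE : young lam = young nu `|` R.
  apply/fsetP => b; rewrite in_fsetU in_fsetD.
  by have := fsubsetP sub b; case: (b \in young nu) => [->//|].
have dis : [disjoint R & young nu]%fset.
  by apply/fdisjointP => b; rewrite in_fsetD => /andP[].
have lastR R' l' m' : (R', l') \in T' -> tail_at n R' m' ->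
    ribbon_lt le (l', m') (e.1, tail_of_bead e.2).
  move=> Tl' tR'; have [b' Eb' tR2] := evT' _ _ Tl'.
  by rewrite (tail_at_uniq n_gt0 tR' tR2); exact: event_lt_ribbon (ltEe Eb').
have tabT := tab_add n_gt0 le_order tabT' ribR tR dis lamE lastR.
rewrite in_fset; apply/andP; split.
  apply/tabsP; split=> // R' l'; rewrite !inE => /orP[/eqP[-> ->]|/evT'[b' Eb' tR']].
    by exists e.2 => //; rewrite mem_rcons inE -surjective_pairing eqxx.
  by exists b' => //; rewrite mem_rcons inE Eb' orbT.
apply/asboolP => evT; have [|b Eb tRb] := evT R e.1; first by rewrite !inE eqxx.
have bE := tail_of_bead_inj tR tRb; rewrite -bE -surjective_pairing in Eb.
by have := ltEe Eb; rewrite event_lt_irr.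
Qed.

Lemma new_notin lam nu T : ribbon n (young lam `\` young nu) -> T \in tabs E nu ->
  (young lam `\` young nu, e.1) \notin T.
Proof.
move=> ribR /tabsP[tabT _]; apply/negP => Tl; have [b Rb] := ribbon_neq0 n_gt0 ribR.
by have := tab_sub tabT Tl Rb; move: Rb; rewrite in_fsetD => /andP[/negPf->].
Qed.

End Step.

Lemma tabs_nil lam : tabs [::] lam = if lam == delta then [fset fset0] else fset0.
Proof.
have H T : events_in [::] T -> T = fset0.
  move=> ev; apply/fsetP => -[R l]; rewrite in_fset0; apply/negP => /ev [b].
  by rewrite in_nil.
case: eqP => [->|neq]; apply/fsetP => T.
  rewrite in_fset1; apply/tabsP/eqP => [[_ /H//]|->]; split; first exact: tab_empty.
  by move=> R l; rewrite in_fset0.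
rewrite [RHS]in_fset0; apply/negP => /tabsP[tabT /H TE]; apply: neq; apply: young_inj.
apply/fsetP => b; apply/idP/idP; last exact: (fsubsetP (st_sub tabT)).
move=> lamb; apply/negPn/negP => nb.
have [R [l [Tl _]]] := tab_mem tabT lamb nb.
by rewrite TE in_fset0 in Tl.
Qed.

Hypothesis AL : A <= L.
Variable s0 : state.
Hypotheses (s0A : cnt s0 0 = A) (shape0 : shape s0 delta).

Local Open Scope ring_scope.
Variables (I : finType) (Rg : comUnitRingType).
Notation K := (fps I Rg).
Variables (q : K) (X : label -> K).

Definition weight T : K := \prod_(t <- T) (q ^+ ribbon_spin t.1 * X t.2).

Definition event_word E (phi : state -> K) :=
  foldl (fun phi e => up1 n q (X e.1) e.2 phi) phi E.

(** Splitting the tableaux by whether they use the last event [e] matches the two terms of [up1]: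
    those that do are in bijection with the tableaux of the partition before the move, and the new
    ribbon contributes its spin and its label. *)
Lemma tabs_sum E : pairwise event_lt E -> {in E, forall e, (e.2 + n < L)%N} ->
  forall st lam, cnt st 0 = A -> shape st lam ->
  event_word E (vacuum Rg s0) st = \sum_(T <- tabs E lam) weight T.
Proof.
elim/last_ind: E => [|E e IHE] sortE ltEL st lam stA sh.
  rewrite /= tabs_nil /vacuum; case: (eqVneq lam delta) => [lamE|neq].
    rewrite big_seq_fset1 /weight big_seq_fset0; case: eqP => // nst.
    by case: nst; apply: shape_inj stA s0A sh _; rewrite lamE.
  rewrite big_seq_fset0; case: eqP => // sE; case/eqP: neq.
  by apply: shape_uniq sh _; rewrite sE.
move: sortE; rewrite pairwise_rcons => /andP[/allP ltEe sortE].
have lte : (e.2 + n < L)%N by apply: ltEL; rewrite mem_rcons mem_head.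
have {}ltEL : {in E, forall e, (e.2 + n < L)%N}.
  by move=> e' Ee'; apply: ltEL; rewrite mem_rcons inE Ee' orbT.
have {}IHE := IHE sortE ltEL; rewrite /event_word foldl_rcons.
rewrite -/(event_word E _) /up1 (big_fsetID _ (fun T => `[< events_in E T >])) /= tabs_old.
rewrite -(IHE _ _ stA sh).
congr (_ + _); rewrite /up; case: ifP => mv; last first.
  by rewrite (tabs_new_empty ltEe AL stA sh) ?mv // big_seq_fset0 mulr0.
have /andP[sb sbn] := mv; have mvA : cnt (move n e.2 st) 0 = A by rewrite cnt_move0.
have [nu shn] := shape_part mvA.
have [sub ribR tR spinR] := move_ribbon n_gt0 stA lte sb sbn sh shn.
rewrite (tabs_new ltEe AL stA sh lte sb sbn shn) big_imfset /=; last first.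
  move=> T1 T2 T1in T2in E12; rewrite -(fsetU1K (new_notin e ribR T1in)) E12.
  by rewrite fsetU1K //; exact: new_notin T2in.
rewrite (IHE _ _ mvA shn).
rewrite mulrA mulr_sumr [RHS]big_seq [LHS]big_seq; apply: eq_bigr => T Tin.
rewrite /weight big_fsetU1 /=; last exact: new_notin Tin.
by rewrite spinR; ring.
Qed.

End Expansion.

Lemma leq_card_cover n (Q : {fset boxes}) : {in Q, forall R, #|` R| = n} ->
  #|` cover Q| <= n * #|` Q|.
Proof.
move=> cQ; rewrite /cover big_seq.
apply: (@leq_trans (\sum_(R <- Q | R \in Q) n)); last first.
  by rewrite -big_seq big_const_seq count_predT iter_addn_0.
elim/big_rec2: _ => [|R k S QR le]; first by rewrite cardfs0.
by rewrite cardfsU cQ //; apply: leq_trans (leq_subr _ _) _; rewrite leq_add2l.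
Qed.

Lemma young_card (lam : intpart) i j : (i, j) \in young lam ->
  i < #|` young lam| /\ j < #|` young lam|.
Proof.
move=> lamij; have idl := @young_ideal lam; split.
  have <- : #|` [fset (k, j) | k in iota 0 i.+1]| = i.+1.
    by rewrite card_imfset_seq ?iota_uniq ?size_iota // => k k' _ _ [].
  apply: fsubset_leq_card; apply/fsubsetP => b /imfsetP[k].
  by rewrite mem_iota => kE ->; apply: ideal_le lamij _ _ => //; lia.
have <- : #|` [fset (i, k) | k in iota 0 j.+1]| = j.+1.
  by rewrite card_imfset_seq ?iota_uniq ?size_iota // => k k' _ _ [].
apply: fsubset_leq_card; apply/fsubsetP => b /imfsetP[k].
by rewrite mem_iota => kE ->; apply: ideal_le lamij _ _ => //; lia.
Qed.

(** * The ordered list of all events *)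

Section Labels.
Variables (p s : nat) (le : rel ('I_p + 'I_s)).
Hypothesis le_order : label_order le.
Notation label := ('I_p + 'I_s)%type.
Implicit Types (l : label) (T : labelled_ribbons p s).

Definition labels : seq label := sort le (enum {: label}).

Lemma mem_labels l : l \in labels.
Proof. by rewrite mem_sort mem_enum. Qed.

Lemma labels_uniq : uniq labels.
Proof. by rewrite sort_uniq enum_uniq. Qed.

Lemma labels_pairwise : pairwise (fun l l' => le l l' && (l != l')) labels.
Proof.
have [_ tr tot _ _] := le_order.
rewrite pairwise_relI -uniq_pairwise labels_uniq andbT -sorted_pairwise //.
exact: sort_sorted.
Qed.

Lemma sites_pairwise v M :
  pairwise (fun b' b => if v then b < b' else b' < b) (sites v M).
Proof.
case: v; last by rewrite -(sorted_pairwise ltn_trans); exact: iota_ltn_sorted.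
rewrite /sites -sorted_pairwise; last by move=> a b c /= ba cb; exact: ltn_trans cb ba.
by rewrite rev_sorted; exact: iota_ltn_sorted.
Qed.

Variables (n L : nat).

Definition label_events l := [seq (l, b) | b <- sites (vertical_label l) (L - n)].
Definition all_events := flatten [seq label_events l | l <- labels].

Lemma mem_all_events l b : ((l, b) \in all_events) = (b < L - n).
Proof.
apply/flatten_mapP/idP => [[l' _ /mapP[b' + [_ ->]]]|ltb]; first by rewrite mem_sites.
exists l; first exact: mem_labels.
by apply/mapP; exists b; rewrite ?mem_sites.
Qed.

Lemma all_events_pairwise : pairwise (event_lt le) all_events.
Proof.
rewrite /all_events; elim: labels labels_pairwise => //= l ls IHl /andP[/allP lt_l pw].
rewrite pairwise_cat IHl // andbT; apply/andP; split.
  apply/allrelP => -[l1 b1] [l2 b2] /mapP[b _ [-> _]] /flatten_mapP[l' /lt_l + /mapP[b' _ [-> _]]].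
  by rewrite /event_lt /= => ->.
rewrite pairwise_map; have := sites_pairwise (vertical_label l) (L - n).
congr (is_true (pairwise _ _)); apply/funext => b; apply/funext => b'.
by rewrite /event_lt /= eqxx andbF.
Qed.

End Labels.

Lemma part_state (delta : intpart) n A L : #|` young delta| <= A ->
  A + #|` young delta| <= L ->
  exists s0 : state L, [/\ cnt s0 0 = A, shape A s0 delta & fit n A #|` young delta| 0 s0].
Proof.
move=> cA cL; have [||s0 s0A sh] := @shape_state L A delta; first by lia.
  by move=> i j /young_card; lia.
exists s0; split=> //; rewrite /fit muln0; split=> p ltp.
  (* An excess of beads at sites from [c] on would put a box in row [A - c] of the first column,
     impossible since that row index is at least the number of boxes. *)
  have cntE c : c + #|` young delta| <= A -> cnt s0 c = A - c.
    move=> lec; apply/eqP; rewrite eqn_leq; apply/andP; split; last first.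
      by have := cnt_lower c s0A; lia.
    rewrite leqNgt; apply/negP => lt; have c0 : 0 < c by case: c lt {lec} => //; rewrite s0A; lia.
    have := sh (A - c) 0; rewrite (_ : 0 + A - (A - c) = c); last by lia.
    by rewrite lt => /young_card; lia.
  by have := cntS s0 p; rewrite !cntE; try lia; case: (occ s0 p) => //; lia.
apply/negP => sp; have := cntS s0 p; rewrite sp => cp.
have := sh 0 (p - A); rewrite subn0 subnK; last by lia.
by rewrite cp /= => /young_card; lia.
Qed.

Lemma core_state (delta : intpart) n A L (s0 : state L) : 0 < n -> is_core n delta ->
  cnt s0 0 = A -> shape A s0 delta -> forall b, b + n < L -> occ s0 (b + n) -> occ s0 b.
Proof.
move=> n_gt0 core s0A sh b ltb sbn; apply/negPn/negP => sb.
have mA : cnt (move n b s0) 0 = A by rewrite cnt_move0.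
have [nu shn] := shape_part mA.
have [sub ribR _ _] := move_ribbon n_gt0 s0A ltb sb sbn sh shn.
exact: (core nu (conj sub ribR)).
Qed.

Local Open Scope ring_scope.

(** * Super LLT polynomials as entries of words *)

Section Generating.
Variables (p s : nat) (I : finType) (Rg : comUnitRingType).
Notation K := (fps I Rg).
Notation label := ('I_p + 'I_s)%type.
Variables (x : 'I_p -> K) (y : 'I_s -> K) (q : K).
Implicit Types (T : labelled_ribbons p s) (l : label).

Definition letter l : K := match l with inl a => x a | inr b => - y b end.

Lemma weightE T : weight q letter T =
  q ^+ spin T * \prod_i x i ^+ wt T (inl i) * \prod_j (- y j) ^+ wt T (inr j).
Proof.
rewrite /weight big_split /= -mulrA; congr (_ * _).
  by rewrite /spin; elim/big_rec2: _ => [|t k a _ ->]; rewrite ?expr0 // exprD.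
transitivity (\prod_l letter l ^+ wt T l); last by rewrite big_sumType.
have -> : \prod_(t <- T) letter t.2 = \prod_(t <- T) \prod_(l | t.2 == l) letter l.
  by apply: eq_bigr => t _; rewrite (big_pred1 t.2) // => l; rewrite eq_sym.
rewrite (exchange_big_dep xpredT) //=; apply: eq_bigr => l _.
by rewrite big_fset_condE big_const_seq count_predT iter_mulr_1.
Qed.

Hypotheses (x1 : forall i, ordge 1 (x i)) (y1 : forall j, ordge 1 (y j)).

Lemma ordge_letter l : ordge 1 (letter l).
Proof. by case: l => a /=; [|apply: ordgeN]. Qed.

Lemma ordge_weight T : ordge #|` T| (weight q letter T).
Proof.
rewrite /weight; elim: (enum_fset T) => [|t r IHr]; first by rewrite big_nil.
rewrite big_cons /= -mulrA; apply: ordgeMl; apply: (@ordgeM _ _ 1) => //.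
exact: ordge_letter.
Qed.

Variables (n : nat) (le : rel ('I_p + 'I_s)) (delta : intpart).
Hypotheses (n_gt0 : (0 < n)%N) (le_order : label_order le).

(** Each ribbon covers [n] boxes and carries a variable, so a tableau of so large a shape has more
    than [d] variables. *)
Lemma ordge_superLLT (lam : intpart) d :
  (#|` young delta| + n * d < #|` young lam|)%N ->
  ordge d.+1 (superLLT n le lam delta x y q).
Proof.
move=> big_lam; rewrite /superLLT big_seq; apply: ordge_sum => T /in_super_tableaux tabT.
rewrite -weightE; apply: (ordgeW _ (@ordge_weight T)).
have [ribT _ covT] := st_tiling tabT.
have := @leq_card_cover n (ribbons_in T predT) (fun R QR => let: And4 _ _ cR _ := ribT R QR in cR).
rewrite covT cardfsDS ?(st_sub tabT) // => lec.
have leT : (#|` ribbons_in T predT| <= #|` T|)%N.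
  have : (#|` [fset t.1 | t in T]| <= #|` T|)%N by exact: leq_imfset_card.
  apply: leq_trans.
  apply: fsubset_leq_card; apply/fsubsetP => R /ribbons_inP[l Tl _].
  by apply/imfsetP; exists (R, l).
have : (n * d < n * #|` T|)%N.
  by apply: leq_trans (leq_mul (leqnn n) leT); lia.
by rewrite ltn_mul2l n_gt0.
Qed.

Variables (L A : nat) (s0 : state L).
Hypotheses (AL : (A <= L)%N) (s0A : cnt s0 0 = A) (shape0 : shape A s0 delta).

Definition word := [seq (letter l, vertical_label l) | l <- labels le].

Lemma event_wordE (phi : state L -> K) :
  event_word n q letter (all_events le n L) phi = word_up n q word phi.
Proof.
rewrite /all_events /word /event_word /word_up.
elim: (labels le) phi => //= l ls IHl phi; rewrite foldl_cat IHl; congr foldl.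
by rewrite /label_events /sweep_up; elim: (sites _ _) phi => //= b bs IHb phi; rewrite IHb.
Qed.

Lemma super_events (st : state L) (lam : intpart) T : cnt st 0 = A -> shape A st lam ->
  super_tableau n le lam delta T -> events_in n A (all_events le n L) T.
Proof.
move=> stA sh tabT R l Tl; have [m tR] := ribbon_tail_at n_gt0 (tab_ribbon tabT Tl).
have [[i j] Rb bE] := tail_at_min n_gt0 tR; have [[i' j'] Rb' bE'] := tail_at_max n_gt0 tR.
have [lti _] := shape_in stA sh (tab_sub tabT Tl Rb).
have ltj := shape_col stA sh (tab_sub tabT Tl Rb').
exists `|(m + A%:Z - 1)%R|%N; first rewrite mem_all_events.
  by move: bE bE'; rewrite /content /=; lia.
have -> : tail_of_bead A `|(m + A%:Z - 1)%R|%N = m.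
  by move: bE; rewrite /tail_of_bead /content /=; lia.
by [].
Qed.

Lemma tabs_all (st : state L) (lam : intpart) : cnt st 0 = A -> shape A st lam ->
  tabs n A le delta (all_events le n L) lam = super_tableaux n le lam delta.
Proof.
move=> stA sh; apply/fsetP => T; apply/tabsP/in_super_tableaux => [[]//|tabT]; split=> //.
exact: (super_events stA sh tabT).
Qed.

Theorem word_up_superLLT (st : state L) (lam : intpart) : cnt st 0 = A -> shape A st lam ->
  word_up n q word (vacuum Rg s0) st = superLLT n le lam delta x y q.
Proof.
move=> stA sh; rewrite -event_wordE /superLLT.
rewrite (tabs_sum n_gt0 le_order AL s0A shape0 q letter (all_events_pairwise _ _ _) _ stA sh) //.
  by rewrite (tabs_all stA sh); apply: eq_bigr => T _; rewrite weightE.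
by move=> [l b]; rewrite mem_all_events /=; lia.
Qed.

(** Peeling off the last ribbon again and again turns a tableau into a chain of ribbon removals
    ending at [delta]. *)
Lemma tabs_removal E (st : state L) (lam : intpart) T : pairwise (event_lt le) E -> cnt st 0 = A ->
  shape A st lam -> {in E, forall e, (e.2 + n < L)%N} ->
  T \in tabs n A le delta E lam -> ribbon_removal n lam delta.
Proof.
elim/last_ind: E st lam T => [|E e IHE] st lam T.
  by rewrite tabs_nil; case: eqP => [-> *|]; rewrite ?in_fset0 //; constructor.
rewrite pairwise_rcons => /andP[/allP ltEe sortE] stA sh ltEL Tin.
have ltEL' : {in E, forall e, (e.2 + n < L)%N}.
  by move=> e' Ee'; apply: ltEL; rewrite mem_rcons inE Ee' orbT.
have [evT|nev] := pselect (events_in n A E T).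
  apply: (IHE st lam T) => //; apply/tabsP; split=> //.
  by move/tabsP: Tin => [].
have /(new_ribbon n_gt0 ltEe) [tabT [R [Tl tR lastR evT]]] :
    T \in [fset T in tabs n A le delta (rcons E e) lam | ~~ `[< events_in n A E T >]].
  by rewrite in_fset; apply/andP; split => /=; [exact: Tin|apply/asboolP].
have [nu [tabT' RE sb sbn shn]] := new_ribbon_removed n_gt0 le_order AL stA sh tabT Tl tR lastR.
have lte : (e.2 + n < L)%N by apply: ltEL; rewrite mem_rcons mem_head.
have [sub ribR _ _] := move_ribbon n_gt0 stA lte sb sbn sh shn.
apply: (ribbon_removal_step (mu := nu)); first by split.
apply: (IHE (move n e.2 st) nu (T `\ (R, e.1))) => //; first by rewrite cnt_move0.
exact/tabsP.
Qed.

(** The pairing runs over all states, the Cauchy sum only over partitions with core [delta]; the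
    surplus terms vanish. *)
Lemma superLLT_core (st : state L) (lam : intpart) : is_core n delta ->
  cnt st 0 = A -> shape A st lam ->
  ~ has_core n lam delta -> superLLT n le lam delta x y q = 0.
Proof.
move=> core stA sh ncore; rewrite /superLLT big_seq big1 // => T.
rewrite -(tabs_all stA sh) => Tin; case: ncore; split=> //.
apply: (tabs_removal (all_events_pairwise _ _ _) stA sh _ Tin) => //.
by move=> [l b]; rewrite mem_all_events /=; lia.
Qed.

(** Moves preserve the number of beads, so states that encode no partition do not contribute to the
    pairing. *)
Lemma word_up_count (st : state L) : cnt st 0 <> A -> word_up n q word (vacuum Rg s0) st = 0.
Proof.
pose supp (phi : state L -> K) := forall st, cnt st 0 <> A -> phi st = 0.
suff H phi : {in all_events le n L, forall e, (e.2 + n < L)%N} -> supp phi ->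
    supp (event_word n q letter (all_events le n L) phi).
  rewrite -event_wordE; apply: H => [[l b]|st' st'A].
    by rewrite mem_all_events /=; lia.
  by rewrite /vacuum; case: eqP => // stE; case: st'A; rewrite stE.
elim: (all_events le n L) phi => //= e E IHE phi event_lt sphi; apply: IHE.
  by move=> e' Ee'; apply: event_lt; rewrite inE Ee' orbT.
have lte : (e.2 + n < L)%N by apply: event_lt; rewrite mem_head.
move=> st' st'A; rewrite /up1 sphi // /up; case: ifP => [/andP[sb sbn]|_].
  by rewrite (sphi (move n e.2 st')) ?mulr0 ?addr0 // cnt_move0.
by rewrite mulr0 addr0.
Qed.

End Generating.

Section Products.
Variable K : comUnitRingType.

Lemma unitr_prod (J : Type) (r : seq J) (F : J -> K) :
  (forall j, F j \is a GRing.unit) -> \prod_(j <- r) F j \is a GRing.unit.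
Proof.
move=> uF; elim/big_rec: _ => [|j a _ ua]; first exact: unitr1.
by rewrite unitrM uF.
Qed.

Lemma prodrV (J : Type) (r : seq J) (F : J -> K) :
  (forall j, F j \is a GRing.unit) -> \prod_(j <- r) (F j)^-1 = (\prod_(j <- r) F j)^-1.
Proof.
move=> uF; elim: r => [|j r IHr]; first by rewrite !big_nil invr1.
by rewrite !big_cons IHr invrM ?unitr_prod // mulrC.
Qed.

End Products.

(** * The Cauchy identity *)

Section Cauchy.
Variables (n : nat) (I : finType) (Rg : comUnitRingType) (p s u v : nat).
Notation K := (fps I Rg).
Variables (le1 : rel ('I_p + 'I_s)) (le2 : rel ('I_u + 'I_v)).
Variables (q : K) (x : 'I_p -> K) (y : 'I_s -> K) (w : 'I_u -> K) (z : 'I_v -> K).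
Hypotheses (x1 : forall i, ordge 1 (x i)) (y1 : forall j, ordge 1 (y j))
  (w1 : forall k, ordge 1 (w k)) (z1 : forall l, ordge 1 (z l)).

Lemma prod_labels (a b : nat) (le : rel ('I_a + 'I_b)) (F : 'I_a + 'I_b -> K) :
  \prod_(l <- labels le) F l = \prod_i F (inl i) * \prod_j F (inr j).
Proof.
transitivity (\prod_l F l); last by rewrite big_sumType.
by rewrite -[RHS]big_enum; apply: perm_big; rewrite /labels perm_sort.
Qed.

Definition cauchy_kernel : K := \prod_(t < n)
       ((\prod_i \prod_l (1 - q ^+ (2 * t) * x i * z l) *
         \prod_j \prod_k (1 - q ^+ (2 * t) * y j * w k)) /
        (\prod_i \prod_k (1 - q ^+ (2 * t) * x i * w k) *
         \prod_j \prod_l (1 - q ^+ (2 * t) * y j * z l))).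

Lemma unit_term (a b : K) t : ordge 1 a -> ordge 1 b ->
  1 - q ^+ (2 * t) * a * b \is a GRing.unit.
Proof.
move=> a1 b1; apply: fps_unit1.
have : ordge 1 (- (q ^+ (2 * t) * a * b)) by apply/ordgeN/ordgeMl.
by apply; rewrite mdeg0.
Qed.

Lemma prod_rotate (a b : nat) (F : 'I_a -> 'I_b -> 'I_n -> K) :
  \prod_k \prod_i \prod_t F i k t = \prod_t \prod_i \prod_k F i k t.
Proof.
rewrite exchange_big /=; under eq_bigr => i _ do rewrite exchange_big /=.
by rewrite exchange_big.
Qed.

(** Labels of equal kind give inverse factors, labels of opposite kinds polynomial ones. The signs
    of the letters [- y] and [- z] cancel in the product of both and turn [1 + ...] into [1 - ...]
    when only one of them occurs. *)
Lemma exchange_factor_kernel :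
  \prod_(e2 <- word w z le2) \prod_(e1 <- word x y le1) exchange_factor n q e1.2 e2.2 e1.1 e2.1 =
  cauchy_kernel.
Proof.
rewrite big_map prod_labels /=.
under eq_bigr => k _ do rewrite big_map prod_labels /= /exchange_factor /=.
under [X in _ * X]eq_bigr => l _ do rewrite big_map prod_labels /= /exchange_factor /=.
rewrite !big_split /= /cauchy_kernel !big_split /=.
have E1 : \prod_k \prod_i (\prod_(t < n) (1 - x i * w k * q ^+ (2 * t)))^-1 =
    (\prod_(t < n) \prod_i \prod_k (1 - q ^+ (2 * t) * x i * w k))^-1.
  rewrite -prod_rotate -prodrV => [|k]; last first.
    by apply: unitr_prod => i; apply: unitr_prod => t; apply: unit_term.
  apply: eq_bigr => k _; rewrite -prodrV => [|i]; last first.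
    by apply: unitr_prod => t; apply: unit_term.
  by apply: eq_bigr => i _; congr (_^-1); apply: eq_bigr => t _; ring.
have E2 : \prod_l \prod_j (\prod_(t < n) (1 - - y j * - z l * q ^+ (2 * t)))^-1 =
    (\prod_(t < n) \prod_j \prod_l (1 - q ^+ (2 * t) * y j * z l))^-1.
  rewrite -prod_rotate -prodrV => [|k]; last first.
    by apply: unitr_prod => i; apply: unitr_prod => t; apply: unit_term.
  apply: eq_bigr => k _; rewrite -prodrV => [|i]; last first.
    by apply: unitr_prod => t; apply: unit_term.
  by apply: eq_bigr => i _; congr (_^-1); apply: eq_bigr => t _; ring.
have E3 : \prod_l \prod_i \prod_(t < n) (1 + x i * - z l * q ^+ (2 * t)) =
    \prod_(t < n) \prod_i \prod_l (1 - q ^+ (2 * t) * x i * z l).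
  rewrite -prod_rotate; apply: eq_bigr => l _; apply: eq_bigr => i _.
  by apply: eq_bigr => t _; ring.
have E4 : \prod_k \prod_j \prod_(t < n) (1 + - y j * w k * q ^+ (2 * t)) =
    \prod_(t < n) \prod_j \prod_k (1 - q ^+ (2 * t) * y j * w k).
  rewrite -prod_rotate; apply: eq_bigr => l _; apply: eq_bigr => i _.
  by apply: eq_bigr => t _; ring.
rewrite E1 E2 E3 E4 prodrV => [|t]; last first.
  by rewrite unitrM; apply/andP; split; do 2!(apply: unitr_prod => ?); apply: unit_term.
rewrite big_split /= invrM; first ring.
  by do 3!(apply: unitr_prod => ?); apply: unit_term.
by do 3!(apply: unitr_prod => ?); apply: unit_term.
Qed.

Hypotheses (n_gt0 : (0 < n)%N) (le1_order : label_order le1) (le2_order : label_order le2).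

Theorem cauchy (delta : intpart) : is_core n delta ->
  fps_has_sum (fun lam : intpart => has_core n lam delta)
    (fun lam => superLLT n le1 lam delta x y q * superLLT n le2 lam delta w z q)
    cauchy_kernel.
Proof.
move=> core m; pose d := mdeg m; pose c := #|` young delta|.
(* The reach [c + n * d] on either side of the origin, plus a full block of [n] sites at each
   end. *)
pose A := (n + c + n * d)%N; pose L := (A + c + n * d + n)%N.
have AL : (A <= L)%N by rewrite /L; lia.
have [||s0 [s0A sh0 fit0]] := @part_state delta n A L; try by rewrite /L /A /c; lia.
have core0 := core_state n_gt0 core s0A sh0.
have o1 : {in word x y le1, forall e, ordge 1 e.1}.
  by move=> e /mapP[l _ ->]; apply: ordge_letter.
have o2 : {in word w z le2, forall e, ordge 1 e.1}.
  by move=> e /mapP[l _ ->]; apply: ordge_letter.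
have pairE := @pairing_words n L A c n_gt0 I Rg q d (leqnn _) (leqnn _) s0 fit0 core0 _ _ o1 o2.
(* States whose bead number is not [A] get the dummy value [delta] and are discarded by [ok]. *)
have exP (st : state L) : exists lam, cnt st 0 = A -> shape A st lam.
  have [stA|nstA] := pselect (cnt st 0 = A); last by exists delta.
  by have [lam sh] := shape_part stA; exists lam.
have [part partP] := choice exP.
pose ok (st : state L) := (cnt st 0 == A) && `[< has_core n (part st) delta >].
exists [seq part st | st <- enum {: state L} & ok st]; split.
- rewrite map_inj_in_uniq; first by apply: filter_uniq; exact: enum_uniq.
  move=> st st'.
  rewrite !mem_filter => /andP[/andP[/eqP stA _] _] /andP[/andP[/eqP st'A _] _] E.
  by apply: (shape_inj stA st'A (partP _ stA)); rewrite E; exact: partP.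
- by move=> lam /mapP[st]; rewrite mem_filter => /andP[/andP[_ /asboolP coreP] _] ->.
- move=> lam coreP notin.
  (* A partition missing from the list does not fit in the window, so it has more than [c + n * d]
     boxes and contributes only in degrees above that of [m]. *)
  suff big_lam : (c + n * d < #|` young lam|)%N.
    have O := @ordgeMl _ _ d.+1 (superLLT n le1 lam delta x y q) _
      (ordge_superLLT q w1 z1 le2 n_gt0 big_lam).
    by apply: O.
  rewrite ltnNge; apply: contra notin => small.
  have [|st stA sh] := @shape_state L A lam AL.
    by move=> i j /young_card; rewrite /L /A; lia.
  apply/mapP; exists st; last exact: shape_uniq sh (partP _ stA).
  rewrite mem_filter mem_enum andbT /ok stA eqxx /=; apply/asboolP.
  by rewrite (shape_uniq (partP _ stA) sh).
have := pairE m (leqnn _); rewrite fps_coefB exchange_factor_kernel => /eqP.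
rewrite subr_eq0 => /eqP <-.
rewrite big_map big_filter /pairing fps_coef_sum big_enum_cond /= big_mkcond /=.
apply: eq_bigr => st _; case: ifP => [/andP[/eqP stA _]|].
  by rewrite (word_up_superLLT x y q n_gt0 le1_order AL s0A sh0 stA (partP _ stA))
    (word_up_superLLT w z q n_gt0 le2_order AL s0A sh0 stA (partP _ stA)).
have [stA|/eqP nstA] := eqVneq (cnt st 0) A.
  rewrite /ok stA eqxx /= => /asboolP ncore.
  rewrite (word_up_superLLT x y q n_gt0 le1_order AL s0A sh0 stA (partP _ stA)).
  by rewrite (superLLT_core x y q n_gt0 le1_order AL s0A core stA (partP _ stA)) // mul0r.
by rewrite (word_up_count x y q le1 n_gt0 AL s0A nstA) mul0r.
Qed.

End Cauchy.

Theorem corollary3p3 (n : nat) (delta : intpart) (p s u v : nat)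
    (le1 : rel ('I_p + 'I_s)) (le2 : rel ('I_u + 'I_v)) :
  (0 < n)%N -> is_core n delta -> label_order le1 -> label_order le2 ->
  let K := fps (('I_p + 'I_s) + ('I_u + 'I_v))%type {poly int} in
  let x : 'I_p -> K := fun i => fpsX _ (inl (inl i)) in
  let y : 'I_s -> K := fun j => fpsX _ (inl (inr j)) in
  let w : 'I_u -> K := fun k => fpsX _ (inr (inl k)) in
  let z : 'I_v -> K := fun l => fpsX _ (inr (inr l)) in
  let q : K := fpsC 'X in
  fps_has_sum (fun lam : intpart => has_core n lam delta)
    (fun lam => superLLT n le1 lam delta x y q * superLLT n le2 lam delta w z q)
    (\prod_(t < n)
       ((\prod_i \prod_l (1 - q ^+ (2 * t) * x i * z l) *
         \prod_j \prod_k (1 - q ^+ (2 * t) * y j * w k)) /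
        (\prod_i \prod_k (1 - q ^+ (2 * t) * x i * w k) *
         \prod_j \prod_l (1 - q ^+ (2 * t) * y j * z l)))).
Proof.
move=> n_gt0 core o1 o2 K x y w z q.
have X1 i : ordge 1 (fpsX _ i : K).
  move=> m; rewrite ltnS leqn0 mdeg_eq0 /fpsX => /eqP ->.
  by rewrite eq_sym mnm1_eq0.
by apply: cauchy => // i; exact: X1.
Qed.
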